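(* Over $\mathsf{CT}^-$, $\mathsf{DC}_{out}$ implies $\mathsf{SeqInd}$; that is, $\mathsf{CT}^-+\mathsf{DC}_{out}\vdash\mathsf{SeqInd}$.
   Context: Work in the language $\mathcal{L}_{PA}=\{S,+,\times,0\}$ of Peano Arithmetic $\mathsf{PA}$ with a standard Gödel coding of syntax inside $\mathsf{PA}$; syntactic objects are identified with their codes, and the formalised syntactic notions (arithmetical sentence, formula, variable, closed term, the numeral $\underline{x}$ of a number $x$, the value $\mathrm{val}(t)$ of a closed term $t$, substitution) are the standard ones. $\mathsf{CT}^-$ is the theory in $\mathcal{L}_{PA}\cup\{T\}$, $T$ a fresh unary predicate, consisting of $\mathsf{PA}$ (induction only for $\mathcal{L}_{PA}$-formulas) together with: (1) $\forall x\,(T(x)\to x$ is an arithmetical sentence$)$; (2) for all closed terms $s,t$: $T(s=t)\leftrightarrow \mathrm{val}(s)=\mathrm{val}(t)$; (3) for all arithmetical sentences $\phi,\psi$: $T(\neg\phi)\leftrightarrow\neg T\phi$, $T(\phi\vee\psi)\leftrightarrow(T\phi\vee T\psi)$, $T(\phi\wedge\psi)\leftrightarrow(T\phi\wedge T\psi)$; (4) for every arithmetical formula $\phi$ and variable $v$ such that $\exists v\phi$ (resp. $\forall v\phi$) is a sentence: $T(\exists v\phi)\leftrightarrow\exists x\,T\phi(\underline{x})$ and $T(\forall v\phi)\leftrightarrow\forall x\,T\phi(\underline{x})$; (5) (Regularity) for every arithmetical formula $\phi$ and all sequences of closed terms $\bar s,\bar t$ of the same length whose sequences of values are equal, $T\phi(\bar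 s)\leftrightarrow T\phi(\bar t)$. For a coded sequence $\bar\phi=(\phi_0,\dots,\phi_c)$ of arithmetical sentences, the disjunction $\bigvee\bar\phi=\bigvee_{i\le c}\phi_i$ is defined with parentheses grouped to the left: $\bigvee_{i\le 0}\phi_i=\phi_0$ and $\bigvee_{i\le c+1}\phi_i=(\bigvee_{i\le c}\phi_i)\vee\phi_{c+1}$. $\mathsf{DC}_{out}$ is the axiom: for every coded sequence $\bar\phi$ of arithmetical sentences, if $T(\bigvee\bar\phi)$ then $T(\phi_i)$ for some $i$ in the index range of $\bar\phi$. $\mathsf{SeqInd}$ (sequential induction) is the axiom: for every coded finite sequence $s$, if $T(s_0)$ and $\forall i<\mathrm{lh}(s)-1\,(T(s_i)\to T(s_{i+1}))$, then $\forall j<\mathrm{lh}(s)\ T(s_j)$. *)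

(* Defs.v *)
From Stdlib Require Import List Arith.
Import ListNotations.

(** * First-order logic over S, +, *, 0 and the truth predicate T *)

(* Variables are named by natural numbers. *)
Inductive term : Type :=
| tvar (x : nat)
| tzero
| tsucc (t : term)
| tadd (s t : term)
| tmul (s t : term).

Inductive form : Type :=
| fEq (s t : term)
| fT (t : term)
| fNot (p : form)
| fOr (p q : form)
| fAnd (p q : form)
| fEx (x : nat) (p : form)
| fAll (x : nat) (p : form).

Definition fImp (p q : form) : form := fOr (fNot p) q.
Definition fIff (p q : form) : form := fAnd (fImp p q) (fImp q p).

Fixpoint tfv (t : term) : list nat :=
  match t with
  | tvar x => [x]
  | tzero => []
  | tsucc t => tfv t
  | tadd s t | tmul s t => tfv s ++ tfv t
  end.

Fixpoint fv (p : form) : list nat :=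
  match p with
  | fEq s t => tfv s ++ tfv t
  | fT t => tfv t
  | fNot p => fv p
  | fOr p q | fAnd p q => fv p ++ fv q
  | fEx x p | fAll x p => remove Nat.eq_dec x (fv p)
  end.

(* The formulas of the language of PA. *)
Fixpoint arith (p : form) : Prop :=
  match p with
  | fEq _ _ => True
  | fT _ => False
  | fNot p => arith p
  | fOr p q | fAnd p q => arith p /\ arith q
  | fEx _ p | fAll _ p => arith p
  end.

Fixpoint tsubst (x : nat) (u t : term) : term :=
  match t with
  | tvar y => if Nat.eq_dec x y then u else tvar y
  | tzero => tzero
  | tsucc t => tsucc (tsubst x u t)
  | tadd s t => tadd (tsubst x u s) (tsubst x u t)
  | tmul s t => tmul (tsubst x u s) (tsubst x u t)
  end.

(* Substitutes u for the free occurrences of x; bound variables are not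
   renamed, so every use is guarded by [free_for]. *)
Fixpoint subst (x : nat) (u : term) (p : form) : form :=
  match p with
  | fEq s t => fEq (tsubst x u s) (tsubst x u t)
  | fT t => fT (tsubst x u t)
  | fNot p => fNot (subst x u p)
  | fOr p q => fOr (subst x u p) (subst x u q)
  | fAnd p q => fAnd (subst x u p) (subst x u q)
  | fEx y p => if Nat.eq_dec x y then fEx y p else fEx y (subst x u p)
  | fAll y p => if Nat.eq_dec x y then fAll y p else fAll y (subst x u p)
  end.

Fixpoint free_for (u : term) (x : nat) (p : form) : Prop :=
  match p with
  | fEq _ _ | fT _ => True
  | fNot p => free_for u x p
  | fOr p q | fAnd p q => free_for u x p /\ free_for u x q
  | fEx y p | fAll y p =>
      ~ In x (remove Nat.eq_dec y (fv p)) \/ (~ In y (tfv u) /\ free_for u x p)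
  end.

(* Classical natural deduction with equality. *)
Inductive prv : list form -> form -> Prop :=
| prv_ax G p : In p G -> prv G p
| prv_weak G D p : incl G D -> prv G p -> prv D p
| prv_notI G p q : prv (p :: G) q -> prv (p :: G) (fNot q) -> prv G (fNot p)
| prv_notE G p q : prv G p -> prv G (fNot p) -> prv G q
| prv_dn G p : prv G (fNot (fNot p)) -> prv G p
| prv_andI G p q : prv G p -> prv G q -> prv G (fAnd p q)
| prv_andE1 G p q : prv G (fAnd p q) -> prv G p
| prv_andE2 G p q : prv G (fAnd p q) -> prv G q
| prv_orI1 G p q : prv G p -> prv G (fOr p q)
| prv_orI2 G p q : prv G q -> prv G (fOr p q)
| prv_orE G p q r :
    prv G (fOr p q) -> prv (p :: G) r -> prv (q :: G) r -> prv G r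
| prv_allI G x p :
    (forall q, In q G -> ~ In x (fv q)) -> prv G p -> prv G (fAll x p)
| prv_allE G x p t : free_for t x p -> prv G (fAll x p) -> prv G (subst x t p)
| prv_exI G x p t : free_for t x p -> prv G (subst x t p) -> prv G (fEx x p)
| prv_exE G x p q :
    (forall r, In r G -> ~ In x (fv r)) -> ~ In x (fv q) ->
    prv G (fEx x p) -> prv (p :: G) q -> prv G q
| prv_eq_refl G t : prv G (fEq t t)
| prv_eq_subst G x p s t :
    free_for s x p -> free_for t x p ->
    prv G (fEq s t) -> prv G (subst x s p) -> prv G (subst x t p).

Definition theory : Type := form -> Prop.

Definition proves (A : theory) (p : form) : Prop :=
  exists G, (forall q, In q G -> A q) /\ prv G p.

Definition closure (p : form) : form := fold_right fAll p (fv p).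

(** * Writing formulas with Rocq binders *)

(* A [pre] is a formula awaiting the number d of binders above it; a quantifier
   placed under d binders binds the variable named d. So, as long as the free
   variables of the terms in use are named below d, no capture occurs; sentences
   are obtained by [build], at d = 0. *)
Definition pre : Type := nat -> form.

Definition build (p : pre) : form := p 0.

Definition pEq (s t : term) : pre := fun _ => fEq s t.
Definition pT (t : term) : pre := fun _ => fT t.
Definition pNot (p : pre) : pre := fun d => fNot (p d).
Definition pOr (p q : pre) : pre := fun d => fOr (p d) (q d).
Definition pAnd (p q : pre) : pre := fun d => fAnd (p d) (q d).
Definition pImp (p q : pre) : pre := fun d => fImp (p d) (q d).
Definition pIff (p q : pre) : pre := fun d => fIff (p d) (q d).
Definition pEx (f : term -> pre) : pre := fun d => fEx d (f (tvar d) (S d)).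
Definition pAll (f : term -> pre) : pre := fun d => fAll d (f (tvar d) (S d)).

Declare Scope tm_scope.
Delimit Scope tm_scope with tm.
Bind Scope tm_scope with term.
Declare Scope pre_scope.
Delimit Scope pre_scope with pre.
Bind Scope pre_scope with pre.

Notation "s + t" := (tadd s t) : tm_scope.
Notation "s * t" := (tmul s t) : tm_scope.

Notation "s ≡ t" := (pEq s%tm t%tm) (at level 70) : pre_scope.
Notation "s ≢ t" := (pNot (pEq s%tm t%tm)) (at level 70) : pre_scope.
Notation "¬ p" := (pNot p) (at level 75, right associativity) : pre_scope.
Notation "p ∧ q" := (pAnd p q) (at level 80, right associativity) : pre_scope.
Notation "p ∨ q" := (pOr p q) (at level 85, right associativity) : pre_scope.
Notation "p → q" := (pImp p q) (at level 99, q at level 200, right associativity) : pre_scope.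
Notation "p ↔ q" := (pIff p q) (at level 95, no associativity) : pre_scope.
Notation "∃ x .. y , p" := (pEx (fun x => .. (pEx (fun y => p%pre)) ..))
  (at level 200, x binder, y binder, right associativity) : pre_scope.
Notation "∀ x .. y , p" := (pAll (fun x => .. (pAll (fun y => p%pre)) ..))
  (at level 200, x binder, y binder, right associativity) : pre_scope.

Local Open Scope pre_scope.

(** * Peano Arithmetic *)

Definition induction_ax (x : nat) (p : form) : form :=
  fImp (fAnd (subst x tzero p) (fAll x (fImp p (subst x (tsucc (tvar x)) p))))
       (fAll x p).

Inductive PA : theory :=
| PA_succ_neq0 : PA (build (∀ x, tsucc x ≢ tzero))
| PA_succ_inj : PA (build (∀ x y, tsucc x ≡ tsucc y → x ≡ y))
| PA_add0 : PA (build (∀ x, x + tzero ≡ x))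
| PA_addS : PA (build (∀ x y, x + tsucc y ≡ tsucc (x + y)))
| PA_mul0 : PA (build (∀ x, x * tzero ≡ tzero))
| PA_mulS : PA (build (∀ x y, x * tsucc y ≡ x * y + x))
| PA_induction x p : arith p -> PA (closure (induction_ax x p)).

(** * Finite sequences in PA *)

Fixpoint numeral (n : nat) : term :=
  match n with 0 => tzero | S n => tsucc (numeral n) end.

(* (x + y)^2 + x is injective in (x, y). *)
Definition cPair (x y : term) : term := ((x + y) * (x + y) + x)%tm.

Definition Lt (x y : term) : pre := ∃ z, x + tsucc z ≡ y.

(* Gödel's beta function: x is the remainder of c modulo 1 + (i + 1) d. *)
Definition Beta (c d i x : term) : pre :=
  (∃ q, c ≡ q * tsucc (tsucc i * d) + x) ∧ Lt x (tsucc (tsucc i * d)).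

(* The sequence of length l with entries Beta(c, d, i), i < l, has the code
   <l, <c, d>>. *)
Definition Lh (s l : term) : pre := ∃ c d, s ≡ cPair l (cPair c d).

Definition Elt (s i x : term) : pre :=
  ∃ l c d, s ≡ cPair l (cPair c d) ∧ Lt i l ∧ Beta c d i x.

Definition Prior (s i x : term) : pre := ∃ j, Lt j i ∧ Elt s j x.

(* x is an entry of a coded sequence whose every entry follows by [step] from
   earlier ones; [step P y] says that y follows from the objects satisfying P. *)
Definition Derivable (step : (term -> pre) -> term -> pre) (x : term) : pre :=
  ∃ s, (∀ i y, Elt s i y → step (Prior s i) y) ∧ (∃ i, Elt s i x).

(** * Arithmetised syntax of the language of PA *)

Definition cVar (i : term) : term := cPair (numeral 0) i.
Definition cZero : term := cPair (numeral 1) tzero.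
Definition cSucc (t : term) : term := cPair (numeral 2) t.
Definition cAdd (s t : term) : term := cPair (numeral 3) (cPair s t).
Definition cMul (s t : term) : term := cPair (numeral 4) (cPair s t).
Definition cEq (s t : term) : term := cPair (numeral 5) (cPair s t).
Definition cNot (p : term) : term := cPair (numeral 6) p.
Definition cOr (p q : term) : term := cPair (numeral 7) (cPair p q).
Definition cAnd (p q : term) : term := cPair (numeral 8) (cPair p q).
Definition cEx (v p : term) : term := cPair (numeral 9) (cPair v p).
Definition cAll (v p : term) : term := cPair (numeral 10) (cPair v p).

Definition Var (v : term) : pre := ∃ i, v ≡ cVar i.

Definition Term : term -> pre :=
  Derivable (fun P x =>
    Var x ∨ x ≡ cZero
    ∨ (∃ y, P y ∧ x ≡ cSucc y)
    ∨ (∃ y z, P y ∧ P z ∧ (x ≡ cAdd y z ∨ x ≡ cMul y z))).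

Definition Formula : term -> pre :=
  Derivable (fun P x =>
    (∃ y z, Term y ∧ Term z ∧ x ≡ cEq y z)
    ∨ (∃ y, P y ∧ x ≡ cNot y)
    ∨ (∃ y z, P y ∧ P z ∧ (x ≡ cOr y z ∨ x ≡ cAnd y z))
    ∨ (∃ v y, Var v ∧ P y ∧ (x ≡ cEx v y ∨ x ≡ cAll v y))).

(* The variable v occurs free in the term or formula x. *)
Definition FreeIn (v : term) : term -> pre :=
  Derivable (fun P x =>
    x ≡ v
    ∨ (∃ y, P y ∧ (x ≡ cSucc y ∨ x ≡ cNot y))
    ∨ (∃ y z, (P y ∨ P z) ∧
         (x ≡ cAdd y z ∨ x ≡ cMul y z ∨ x ≡ cEq y z ∨ x ≡ cOr y z ∨ x ≡ cAnd y z))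
    ∨ (∃ w y, w ≢ v ∧ P y ∧ (x ≡ cEx w y ∨ x ≡ cAll w y))).

Definition Closed (x : term) : pre := ¬ (∃ v, Var v ∧ FreeIn v x).
Definition Sentence (x : term) : pre := Formula x ∧ Closed x.
Definition ClTerm (t : term) : pre := Term t ∧ Closed t.

(* The closed term t has value y. *)
Definition Val (t y : term) : pre :=
  Derivable (fun P x =>
    x ≡ cPair cZero tzero
    ∨ (∃ t a, P (cPair t a) ∧ x ≡ cPair (cSucc t) (tsucc a))
    ∨ (∃ t a u b, P (cPair t a) ∧ P (cPair u b) ∧
         (x ≡ cPair (cAdd t u) (a + b) ∨ x ≡ cPair (cMul t u) (a * b))))
    (cPair t y).

(* t is the code of the numeral of n. *)
Definition Num (n t : term) : pre :=
  Derivable (fun P x =>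
    x ≡ cPair tzero cZero
    ∨ (∃ m u, P (cPair m u) ∧ x ≡ cPair (tsucc m) (cSucc u)))
    (cPair n t).

(* e' is e with the free occurrences of the variable v replaced by the term u.
   Bound variables are not renamed: [Sub] is only used with closed u. *)
Definition Sub (v u e e' : term) : pre :=
  Derivable (fun P x =>
    x ≡ cPair v u
    ∨ (∃ w, Var w ∧ w ≢ v ∧ x ≡ cPair w w)
    ∨ x ≡ cPair cZero cZero
    ∨ (∃ y y', P (cPair y y') ∧
         (x ≡ cPair (cSucc y) (cSucc y') ∨ x ≡ cPair (cNot y) (cNot y')))
    ∨ (∃ y y' z z', P (cPair y y') ∧ P (cPair z z') ∧
         (x ≡ cPair (cAdd y z) (cAdd y' z')
          ∨ x ≡ cPair (cMul y z) (cMul y' z')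
          ∨ x ≡ cPair (cEq y z) (cEq y' z')
          ∨ x ≡ cPair (cOr y z) (cOr y' z')
          ∨ x ≡ cPair (cAnd y z) (cAnd y' z')))
    ∨ (∃ w y y', Var w ∧ w ≢ v ∧ P (cPair y y') ∧
         (x ≡ cPair (cEx w y) (cEx w y') ∨ x ≡ cPair (cAll w y) (cAll w y')))
    ∨ (∃ y, x ≡ cPair (cEx v y) (cEx v y) ∨ x ≡ cPair (cAll v y) (cAll v y)))
    (cPair e e').

(* For sequences vs of variables and ts of closed terms of the same length, q is
   p with each entry of ts substituted for the corresponding entry of vs, one
   after the other; as the terms are closed and the variables distinct, this is
   the simultaneous substitution. *)
Definition SubSeq (vs ts p q : term) : pre :=
  ∃ l, Lh vs l ∧ Lh ts l ∧
    Derivable (fun P x =>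
      x ≡ cPair tzero p
      ∨ (∃ i r v t r', P (cPair i r) ∧ Elt vs i v ∧ Elt ts i t ∧ Sub v t r r' ∧
           x ≡ cPair (tsucc i) r'))
      (cPair l q).

(* q is the disjunction, grouped to the left, of the nonempty sequence s. *)
Definition BigOr (s q : term) : pre :=
  ∃ c, Lh s (tsucc c) ∧
    Derivable (fun P x =>
      (∃ p, Elt s tzero p ∧ x ≡ cPair tzero p)
      ∨ (∃ i r p, P (cPair i r) ∧ Elt s (tsucc i) p ∧
           x ≡ cPair (tsucc i) (cOr r p)))
      (cPair c q).

(** * The theory CT^- *)

Definition T_sentences : pre := ∀ x, pT x → Sentence x.

Definition T_eq : pre :=
  ∀ s t, ClTerm s ∧ ClTerm t → (pT (cEq s t) ↔ ∃ y, Val s y ∧ Val t y).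

Definition T_not : pre := ∀ p, Sentence p → (pT (cNot p) ↔ ¬ pT p).

Definition T_or : pre :=
  ∀ p q, Sentence p ∧ Sentence q → (pT (cOr p q) ↔ (pT p ∨ pT q)).

Definition T_and : pre :=
  ∀ p q, Sentence p ∧ Sentence q → (pT (cAnd p q) ↔ (pT p ∧ pT q)).

Definition T_inst (p v x : term) : pre := ∃ n q, Num x n ∧ Sub v n p q ∧ pT q.

Definition T_ex : pre :=
  ∀ p v, Formula p ∧ Var v ∧ Sentence (cEx v p) →
    (pT (cEx v p) ↔ ∃ x, T_inst p v x).

Definition T_all : pre :=
  ∀ p v, Formula p ∧ Var v ∧ Sentence (cAll v p) →
    (pT (cAll v p) ↔ ∀ x, T_inst p v x).

Definition DistinctVars (vs : term) : pre :=
  (∀ i v, Elt vs i v → Var v) ∧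
  (∀ i j v, Elt vs i v ∧ Elt vs j v → i ≡ j).

Definition ClTerms (ts : term) : pre := ∀ i t, Elt ts i t → ClTerm t.

Definition T_subst (p vs ts : term) : pre := ∃ q, SubSeq vs ts p q ∧ pT q.

Definition T_regularity : pre :=
  ∀ p vs ss ts l,
    Formula p ∧ DistinctVars vs ∧ ClTerms ss ∧ ClTerms ts ∧
    Lh vs l ∧ Lh ss l ∧ Lh ts l ∧
    (∀ i s t, Elt ss i s ∧ Elt ts i t → ∃ y, Val s y ∧ Val t y) →
    (T_subst p vs ss ↔ T_subst p vs ts).

Inductive CTminus : theory :=
| CT_PA p : PA p -> CTminus p
| CT_sentences : CTminus (build T_sentences)
| CT_eq : CTminus (build T_eq)
| CT_not : CTminus (build T_not)
| CT_or : CTminus (build T_or)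
| CT_and : CTminus (build T_and)
| CT_ex : CTminus (build T_ex)
| CT_all : CTminus (build T_all)
| CT_regularity : CTminus (build T_regularity).

(** * Disjunctive correctness and sequential induction *)

Definition T_elt (s i : term) : pre := ∃ x, Elt s i x ∧ pT x.

Definition DC_out : form := build (
  ∀ s c, Lh s (tsucc c) ∧ (∀ i x, Elt s i x → Sentence x) →
    (∃ q, BigOr s q ∧ pT q) → ∃ i, Lt i (tsucc c) ∧ T_elt s i).

Definition SeqInd : form := build (
  ∀ s l, Lh s l →
    T_elt s tzero ∧ (∀ i, Lt (tsucc i) l → T_elt s i → T_elt s (tsucc i)) →
    ∀ j, Lt j l → T_elt s j).

Definition add_axiom (A : theory) (p : form) : theory := fun q => A q \/ q = p.

(* Main.v *)
(** By completeness it suffices to prove sequential induction in an arbitrary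
    model of [CTminus] and [DC_out]. Let [s] be a sequence of sentences with [s_0]
    true, truth passing from [s_i] to [s_(i+1)], and suppose that [s_j] is not true.
    Define by recursion inside PA
      [phi_0 = ~ s_0], [phi_(i+1) = ~ (delta_i \/ s_(i+1))],
      [delta_0 = phi_0], [delta_(i+1) = delta_i \/ phi_(i+1)],
    so that [phi_i] says that [i] is the least index at which [s] fails. Then
    [delta_j] is true: [delta_(i+1)] is true iff [delta_i] is true or [s_(i+1)] is
    not. Disjunctive correctness gives a true [phi_i]; here [i <> 0], say
    [i = k + 1], and neither [delta_k] nor [s_i] is true. From the former, [s_k] is
    true, hence so is [s_i], a contradiction. Entries that are not sentences are
    excluded by arithmetical induction: if the entries up to [s_i] are sentences,
    then [s_i] is true by the above, hence [s_(i+1)] is true and so a sentence. *)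

From Stdlib Require Import List Arith Lia Classical ClassicalEpsilon.
From Stdlib Require Import FunctionalExtensionality PropExtensionality ProofIrrelevance.
From Stdlib Require Import Cantor Ring.
Require Import Defs.
Import ListNotations.

(** * Tarskian semantics *)

Record structure : Type := Structure {
  dom :> Type;
  zr : dom;
  sc : dom -> dom;
  ad : dom -> dom -> dom;
  mu : dom -> dom -> dom;
  tr : dom -> Prop }.

Definition upd {D : Type} (r : nat -> D) (x : nat) (d : D) : nat -> D :=
  fun y => if Nat.eq_dec x y then d else r y.

Fixpoint eval (M : structure) (r : nat -> M) (t : term) : M :=
  match t with
  | tvar x => r x
  | tzero => zr M
  | tsucc t => sc M (eval M r t)
  | tadd s t => ad M (eval M r s) (eval M r t)
  | tmul s t => mu M (eval M r s) (eval M r t)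
  end.

(* Reading [fOr (fNot p) q] as an implication makes the satisfaction of [fImp]
   and [fIff] convertible to the implication and equivalence of Rocq. *)
Fixpoint sat (M : structure) (r : nat -> M) (p : form) : Prop :=
  match p with
  | fEq s t => eval M r s = eval M r t
  | fT t => tr M (eval M r t)
  | fNot p => ~ sat M r p
  | fOr p q =>
      match p with
      | fNot p' => sat M r p' -> sat M r q
      | _ => sat M r p \/ sat M r q
      end
  | fAnd p q => sat M r p /\ sat M r q
  | fEx x p => exists d, sat M (upd r x d) p
  | fAll x p => forall d, sat M (upd r x d) p
  end.

(** By excluded middle the implication clause of [sat] is the usual disjunction clause, so syntactic
    arguments need no case split on the left disjunct. *)
Lemma sat_or M r p q : sat M r (fOr p q) <-> sat M r p \/ sat M r q.
Proof.
  destruct p; simpl; tauto.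
Qed.

Lemma upd_eq {D} (r : nat -> D) x d : upd r x d x = d.
Proof. unfold upd; destruct (Nat.eq_dec x x); congruence. Qed.

Lemma upd_neq {D} (r : nat -> D) x y d : x <> y -> upd r x d y = r y.
Proof. unfold upd; destruct (Nat.eq_dec x y); congruence. Qed.

Lemma eval_ext M r r' t :
  (forall x, In x (tfv t) -> r x = r' x) -> eval M r t = eval M r' t.
Proof.
  induction t; simpl; intros H; auto.
  - f_equal; auto.
  - f_equal; [apply IHt1 | apply IHt2]; intros; apply H, in_or_app; auto.
  - f_equal; [apply IHt1 | apply IHt2]; intros; apply H, in_or_app; auto.
Qed.

Lemma sat_ext M p : forall r r',
  (forall x, In x (fv p) -> r x = r' x) -> (sat M r p <-> sat M r' p).
Proof.
  assert (U : forall r r' x p, (forall y, In y (remove Nat.eq_dec x (fv p)) -> r y = r' y) ->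
    forall (d : M) y, In y (fv p) -> upd r x d y = upd r' x d y).
  { intros r r' x p0 H d y Hy. unfold upd. destruct (Nat.eq_dec x y); auto.
    apply H, in_in_remove; auto. }
  induction p as [s t|t|p IH|p IHp q IHq|p IHp q IHq|x p IH|x p IH]; intros r r' H.
  - simpl in *. rewrite (eval_ext M r r' s), (eval_ext M r r' t); try tauto;
      intros; apply H, in_or_app; auto.
  - simpl in *. rewrite (eval_ext M r r' t) by auto. tauto.
  - simpl in *. rewrite (IH r r' H); tauto.
  - rewrite !sat_or. simpl in H.
    rewrite (IHp r r'), (IHq r r'); try tauto; intros; apply H, in_or_app; auto.
  - simpl in *.
    rewrite (IHp r r'), (IHq r r'); try tauto; intros; apply H, in_or_app; auto.
  - simpl in *. split; intros [d Hd]; exists d; eapply IH; try exact Hd; intros y Hy;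
      [symmetry|]; apply (U r r' x p); auto.
  - simpl in *. split; intros Hd d; eapply IH; try exact (Hd d); intros y Hy;
      [symmetry|]; apply (U r r' x p); auto.
Qed.

Lemma eval_tsubst M r x u t :
  eval M r (tsubst x u t) = eval M (upd r x (eval M r u)) t.
Proof.
  induction t; simpl; try congruence.
  unfold upd. destruct (Nat.eq_dec x x0); reflexivity.
Qed.

Lemma upd_upd {D} (r : nat -> D) x a b : upd (upd r x a) x b = upd r x b.
Proof. apply functional_extensionality; intro y; unfold upd; destruct Nat.eq_dec; auto. Qed.

Lemma upd_comm {D} (r : nat -> D) x y a b : x <> y -> upd (upd r x a) y b = upd (upd r y b) x a.
Proof.
  intro H; apply functional_extensionality; intro z; unfold upd.
  destruct (Nat.eq_dec y z), (Nat.eq_dec x z); congruence.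
Qed.

Lemma sat_upd_fresh M r x d p :
  ~ In x (fv p) -> (sat M (upd r x d) p <-> sat M r p).
Proof. intro H. apply sat_ext. intros y Hy. apply upd_neq. congruence. Qed.

Lemma eval_upd_fresh M r x d t : ~ In x (tfv t) -> eval M (upd r x d) t = eval M r t.
Proof. intro H. apply eval_ext. intros y Hy. apply upd_neq. congruence. Qed.

Lemma tsubst_not_free x u t : ~ In x (tfv t) -> tsubst x u t = t.
Proof.
  induction t; simpl; intro H; auto.
  - destruct Nat.eq_dec; auto. subst. tauto.
  - f_equal; auto.
  - rewrite in_app_iff in H. f_equal; auto.
  - rewrite in_app_iff in H. f_equal; auto.
Qed.

Lemma subst_not_free x u p : ~ In x (fv p) -> subst x u p = p.
Proof.
  induction p; simpl; intro H; try rewrite in_app_iff in H; f_equal; auto using tsubst_not_free.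
  - destruct Nat.eq_dec; auto. f_equal. apply IHp. intro. apply H, in_in_remove; auto.
  - destruct Nat.eq_dec; auto. f_equal. apply IHp. intro. apply H, in_in_remove; auto.
Qed.

Lemma sat_subst M x u p : forall r, free_for u x p ->
  (sat M r (subst x u p) <-> sat M (upd r x (eval M r u)) p).
Proof.
  (* The case of a quantifier on [y <> x]. Either [x] is not free in the body, and neither the
     substitution nor the update at [x] has an effect, or [y] does not occur in [u], and the value
     of [u] survives the update at [y]. *)
  assert (B : forall r y p, (forall r, free_for u x p ->
      (sat M r (subst x u p) <-> sat M (upd r x (eval M r u)) p)) ->
      x <> y -> ~ In x (remove Nat.eq_dec y (fv p)) \/ ~ In y (tfv u) /\ free_for u x p ->
      forall d, sat M (upd r y d) (subst x u p) <-> sat M (upd (upd r x (eval M r u)) y d) p).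
  { intros r y p0 IH N H d. rewrite upd_comm by auto.
    destruct H as [H|[H1 H2]].
    - assert (~ In x (fv p0)) by (intro; apply H, in_in_remove; auto).
      rewrite subst_not_free, (sat_upd_fresh _ _ x) by auto. tauto.
    - rewrite IH by auto. rewrite eval_upd_fresh by auto. tauto. }
  induction p as [s t|t|p IH|p IHp q IHq|p IHp q IHq|y p IH|y p IH]; intros r H.
  - simpl. rewrite !eval_tsubst. tauto.
  - simpl. rewrite !eval_tsubst. tauto.
  - simpl in *. rewrite IH by auto. tauto.
  - simpl subst. simpl in H. rewrite !sat_or, IHp, IHq by tauto. tauto.
  - simpl in *. rewrite IHp, IHq by tauto. tauto.
  - simpl in *. destruct (Nat.eq_dec x y) as [<-|N]; simpl.
    + split; intros [d Hd]; exists d; rewrite upd_upd in *; auto.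
    + split; intros [d Hd]; exists d; apply (B r y p IH N H d); auto.
  - simpl in *. destruct (Nat.eq_dec x y) as [<-|N]; simpl.
    + split; intros Hd d; specialize (Hd d); rewrite upd_upd in *; auto.
    + split; intros Hd d; apply (B r y p IH N H d); auto.
Qed.

(** Measure for the truth lemma: in the quantifier cases it passes to instances of the body, which
    are not subformulas but have the size of the body. *)
Fixpoint fsize (p : form) : nat :=
  match p with
  | fEq _ _ | fT _ => 0
  | fNot p | fEx _ p | fAll _ p => S (fsize p)
  | fOr p q | fAnd p q => S (fsize p + fsize q)
  end.

Lemma fsize_subst x u p : fsize (subst x u p) = fsize p.
Proof. induction p; simpl; try congruence; destruct Nat.eq_dec; simpl; congruence. Qed.

(** * Fresh variables *)

Local Arguments Nat.max : simpl never.

Fixpoint tbound (t : term) : nat :=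
  match t with
  | tvar x => S x
  | tzero => 0
  | tsucc t => tbound t
  | tadd s t | tmul s t => max (tbound s) (tbound t)
  end.

(** Bound variables count as well, so a variable at or above the bound can neither occur in [p] nor
    be captured in it. *)
Fixpoint fbound (p : form) : nat :=
  match p with
  | fEq s t => max (tbound s) (tbound t)
  | fT t => tbound t
  | fNot p => fbound p
  | fOr p q | fAnd p q => max (fbound p) (fbound q)
  | fEx x p | fAll x p => max (S x) (fbound p)
  end.

Lemma tfv_bound t x : In x (tfv t) -> x < tbound t.
Proof.
  induction t; simpl; intro H; try rewrite in_app_iff in H; try tauto; try lia.
  - destruct H as [H|H]; [apply IHt1 in H|apply IHt2 in H]; lia.
  - destruct H as [H|H]; [apply IHt1 in H|apply IHt2 in H]; lia.
Qed.

Lemma fv_bound p x : In x (fv p) -> x < fbound p.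
Proof.
  induction p; simpl; intro H.
  - rewrite in_app_iff in H. destruct H as [H|H]; apply tfv_bound in H; lia.
  - apply tfv_bound in H; lia.
  - auto.
  - rewrite in_app_iff in H. destruct H as [H|H]; [apply IHp1 in H|apply IHp2 in H]; lia.
  - rewrite in_app_iff in H. destruct H as [H|H]; [apply IHp1 in H|apply IHp2 in H]; lia.
  - apply in_remove in H. destruct H as [H _]. apply IHp in H. lia.
  - apply in_remove in H. destruct H as [H _]. apply IHp in H. lia.
Qed.

Lemma free_for_fresh y x p : fbound p <= y -> free_for (tvar y) x p.
Proof.
  induction p; simpl; intro H; auto.
  - split; [apply IHp1|apply IHp2]; lia.
  - split; [apply IHp1|apply IHp2]; lia.
  - right. split; [lia|]. apply IHp; lia.
  - right. split; [lia|]. apply IHp; lia.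
Qed.

Lemma free_for_self u x p : incl (tfv u) [x] -> free_for u x p.
Proof.
  intro H. induction p; simpl; auto.
  - destruct (Nat.eq_dec x0 x) as [->|N]; [left; apply remove_In|].
    right; split; auto. intro K. apply H in K. simpl in K. intuition.
  - destruct (Nat.eq_dec x0 x) as [->|N]; [left; apply remove_In|].
    right; split; auto. intro K. apply H in K. simpl in K. intuition.
Qed.

Lemma tsubst_back x y t : tbound t <= y -> tsubst y (tvar x) (tsubst x (tvar y) t) = t.
Proof.
  induction t; simpl; intro H.
  - destruct Nat.eq_dec; simpl.
    + destruct Nat.eq_dec; congruence.
    + destruct Nat.eq_dec; auto; lia.
  - auto.
  - f_equal; auto.
  - f_equal; [apply IHt1|apply IHt2]; lia.
  - f_equal; [apply IHt1|apply IHt2]; lia.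
Qed.

(** Renaming to a fresh variable is reversible. This lets an instance at a Henkin witness be turned
    back into the original body. *)
Lemma subst_back x y p : fbound p <= y -> subst y (tvar x) (subst x (tvar y) p) = p.
Proof.
  assert (B : forall q, fbound q <= y -> subst y (tvar x) q = q).
  { intros q H. apply subst_not_free. intro K. apply fv_bound in K. lia. }
  induction p; simpl; intro H.
  - f_equal; apply tsubst_back; lia.
  - f_equal; apply tsubst_back; lia.
  - f_equal; auto.
  - f_equal; [apply IHp1|apply IHp2]; lia.
  - f_equal; [apply IHp1|apply IHp2]; lia.
  - destruct (Nat.eq_dec x x0); simpl; destruct (Nat.eq_dec y x0); try lia; f_equal.
    + apply B; lia.
    + apply IHp; lia.
  - destruct (Nat.eq_dec x x0); simpl; destruct (Nat.eq_dec y x0); try lia; f_equal.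
    + apply B; lia.
    + apply IHp; lia.
Qed.

Lemma tfv_tsubst_var x y t z : In z (tfv (tsubst x (tvar y) t)) -> z = y \/ (z <> x /\ In z (tfv t)).
Proof.
  induction t; simpl; intro H; try rewrite in_app_iff in *; try tauto.
  destruct Nat.eq_dec; simpl in *; [left; intuition|]. right. intuition congruence.
Qed.

Lemma fv_subst_var x y p z : In z (fv (subst x (tvar y) p)) -> z = y \/ (z <> x /\ In z (fv p)).
Proof.
  induction p; simpl; intro H; try rewrite in_app_iff in *.
  - destruct H as [H|H]; apply tfv_tsubst_var in H; intuition.
  - apply tfv_tsubst_var in H; auto.
  - auto.
  - intuition.
  - intuition.
  - destruct Nat.eq_dec; simpl in H; apply in_remove in H; destruct H as [H N].
    + right. subst. split; auto. apply in_in_remove; auto.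
    + apply IHp in H. destruct H as [H|[K H]]; auto. right. split; auto. apply in_in_remove; auto.
  - destruct Nat.eq_dec; simpl in H; apply in_remove in H; destruct H as [H N].
    + right. subst. split; auto. apply in_in_remove; auto.
    + apply IHp in H. destruct H as [H|[K H]]; auto. right. split; auto. apply in_in_remove; auto.
Qed.

Lemma free_for_back x y p : fbound p <= y -> free_for (tvar x) y (subst x (tvar y) p).
Proof.
  induction p; simpl; intro H; auto.
  - split; [apply IHp1|apply IHp2]; lia.
  - split; [apply IHp1|apply IHp2]; lia.
  - destruct Nat.eq_dec as [<-|N]; simpl.
    + left. intro K. apply in_remove in K. destruct K as [K _]. apply fv_bound in K. lia.
    + right. split; [intuition congruence|]. apply IHp; lia.
  - destruct Nat.eq_dec as [<-|N]; simpl.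
    + left. intro K. apply in_remove in K. destruct K as [K _]. apply fv_bound in K. lia.
    + right. split; [intuition congruence|]. apply IHp; lia.
Qed.

(** * Completeness *)

Fixpoint tcode (t : term) : nat :=
  match t with
  | tvar x => to_nat (0, x)
  | tzero => to_nat (1, 0)
  | tsucc t => to_nat (2, tcode t)
  | tadd s t => to_nat (3, to_nat (tcode s, tcode t))
  | tmul s t => to_nat (4, to_nat (tcode s, tcode t))
  end.

Fixpoint fcode (p : form) : nat :=
  match p with
  | fEq s t => to_nat (0, to_nat (tcode s, tcode t))
  | fT t => to_nat (1, tcode t)
  | fNot p => to_nat (2, fcode p)
  | fOr p q => to_nat (3, to_nat (fcode p, fcode q))
  | fAnd p q => to_nat (4, to_nat (fcode p, fcode q))
  | fEx x p => to_nat (5, to_nat (x, fcode p))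
  | fAll x p => to_nat (6, to_nat (x, fcode p))
  end.

Lemma to_nat_pair_inj a b c d : to_nat (a, b) = to_nat (c, d) -> a = c /\ b = d.
Proof. intro H. apply to_nat_inj in H. injection H; auto. Qed.

Lemma tcode_inj s : forall t, tcode s = tcode t -> s = t.
Proof.
  induction s; intros []; cbn [tcode]; intro H; apply to_nat_pair_inj in H;
    destruct H as [H K]; try discriminate H; try apply to_nat_pair_inj in K;
    f_equal; intuition.
Qed.

Lemma fcode_inj p : forall q, fcode p = fcode q -> p = q.
Proof.
  induction p; intros []; cbn [fcode]; intro H; apply to_nat_pair_inj in H;
    destruct H as [H K]; try discriminate H; try apply to_nat_pair_inj in K;
    f_equal; intuition auto using tcode_inj.
Qed.

(** Enumerates all formulas for the Henkin construction; a number that is no code yields an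
    unspecified formula. *)
Definition fdecode (n : nat) : form :=
  epsilon (inhabits (fEq tzero tzero)) (fun p => fcode p = n).

Lemma fdecode_code p : fdecode (fcode p) = p.
Proof.
  apply fcode_inj. unfold fdecode.
  apply (epsilon_spec (inhabits (fEq tzero tzero)) (fun q => fcode q = fcode p)).
  exists p; reflexivity.
Qed.

Definition lbound (G : list form) : nat := fold_right (fun p n => max (fbound p) n) 0 G.

Lemma lbound_in G p : In p G -> fbound p <= lbound G.
Proof. induction G; simpl; [tauto|]. intros [<-|H]; [lia|]. apply IHG in H. lia. Qed.

Lemma prv_cut G a b : prv G a -> prv (a :: G) b -> prv G b.
Proof. intros H K. apply (prv_orE G a a b); auto. apply prv_orI1; auto. Qed.

Section Henkin.

Variable A : theory.
Hypothesis A_closed : forall p, A p -> fv p = [].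

Definition der (G : list form) (p : form) : Prop :=
  exists H, (forall q, In q H -> A q) /\ prv (H ++ G) p.

Definition con (G : list form) : Prop := ~ (exists p, der G p /\ der G (fNot p)).

Lemma der_ax G p : In p G -> der G p.
Proof. intro H. exists []. split; [simpl; tauto|]. apply prv_ax; auto. Qed.

Lemma der_theory G p : A p -> der G p.
Proof.
  intro H. exists [p]. split; [intros q [<-|[]]; auto|]. apply prv_ax; simpl; auto.
Qed.

Lemma der_mono G G' p : incl G G' -> der G p -> der G' p.
Proof.
  intros I [H [HA HP]]. exists H. split; auto. eapply prv_weak; [|exact HP].
  apply incl_app_app; auto using incl_refl.
Qed.

Lemma der_merge G p q r :
  (forall H, prv (H ++ G) p -> prv (H ++ G) q -> prv (H ++ G) r) ->
  der G p -> der G q -> der G r.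
Proof.
  intros R [H [HA HP]] [K [KA KP]]. exists (H ++ K). split.
  - intros x Hx. apply in_app_or in Hx. destruct Hx; auto.
  - apply R.
    + eapply prv_weak; [|exact HP]. apply incl_app_app; auto using incl_refl, incl_appl.
    + eapply prv_weak; [|exact KP]. apply incl_app_app; auto using incl_refl, incl_appr.
Qed.

Lemma der_map G p r : (forall H, prv (H ++ G) p -> prv (H ++ G) r) -> der G p -> der G r.
Proof. intros R [H [HA HP]]. exists H; auto. Qed.

Lemma prv_move H G p q : prv (H ++ p :: G) q -> prv (p :: H ++ G) q.
Proof.
  apply prv_weak. intros x Hx. apply in_app_or in Hx. simpl.
  rewrite in_app_iff. simpl in Hx. intuition.
Qed.

Lemma der_notI G p q : der (p :: G) q -> der (p :: G) (fNot q) -> der G (fNot p).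
Proof.
  intros [H [HA HP]] [K [KA KP]]. exists (H ++ K). split.
  - intros x Hx. apply in_app_or in Hx. destruct Hx; auto.
  - apply prv_notI with q; apply prv_move.
    + eapply prv_weak; [|exact HP]. apply incl_app_app; auto using incl_refl, incl_appl.
    + eapply prv_weak; [|exact KP]. apply incl_app_app; auto using incl_refl, incl_appr.
Qed.

(** The axioms used in the derivation are sentences, so the eigenvariable condition concerns [G]
    alone. *)
Lemma der_allI G x p :
  (forall q, In q G -> ~ In x (fv q)) -> der G p -> der G (fAll x p).
Proof.
  intros F [H [HA HP]]. exists H. split; auto. apply prv_allI; auto.
  intros q Hq. apply in_app_or in Hq. destruct Hq as [Hq|Hq]; auto.
  rewrite A_closed by auto. simpl; tauto.
Qed.

Lemma con_add_not G p : ~ con (p :: G) -> der G (fNot p).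
Proof. intro H. apply NNPP in H. destruct H as [q [H K]]. apply (der_notI G p q); auto. Qed.

Lemma der_prv G a b : der G a -> prv [a] b -> der G b.
Proof.
  intros H K. revert H. apply der_map. intros L H. eapply prv_cut; [exact H|].
  eapply prv_weak; [|exact K]. intros x [<-|[]]; simpl; auto.
Qed.

Lemma prv_no_witness x y q : fbound q <= y ->
  prv [fAll y (fNot (subst x (tvar y) q))] (fNot (fEx x q)).
Proof.
  intro B. set (a := fAll y (fNot (subst x (tvar y) q))).
  assert (Fx : ~ In x (fv a)).
  { intro H. unfold a in H. simpl in H. apply in_remove in H. destruct H as [H N].
    apply fv_subst_var in H. intuition. }
  (* Existential elimination forbids [x] in its conclusion, so the contradiction between [q] and its
     refuted renaming is exported as an arbitrary sentence [r], later [0 = 0] and its negation. *)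
  assert (E : forall r, fv r = [] -> prv [fEx x q; a] r).
  { intros r Hr. apply prv_exE with (x := x) (p := q).
    - intros s [<-|[<-|[]]]; auto. simpl. apply remove_In.
    - rewrite Hr; simpl; tauto.
    - apply prv_ax; simpl; auto.
    - apply prv_notE with q; [apply prv_ax; simpl; auto|].
      assert (K : prv [q; fEx x q; a] (subst y (tvar x) (fNot (subst x (tvar y) q)))).
      { apply prv_allE; [simpl; apply free_for_back; auto|]. apply prv_ax; simpl; auto. }
      simpl in K. rewrite subst_back in K; auto. }
  apply prv_notI with (fEq tzero tzero); apply E; reflexivity.
Qed.

(** Otherwise the list refutes [q] at [y]; as [y] is fresh this generalises over [y], and
    [prv_no_witness] then refutes the existential formula that the list contains. *)
Lemma con_witness G x q y : lbound (fEx x q :: G) <= y ->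
  con (fEx x q :: G) -> con (subst x (tvar y) q :: fEx x q :: G).
Proof.
  intros B C. apply NNPP. intro N. apply con_add_not in N. apply C.
  exists (fEx x q). split; [apply der_ax; simpl; auto|].
  eapply der_prv; [|apply (prv_no_witness x y)].
  - apply der_allI; auto. intros r Hr K. apply lbound_in in Hr. apply fv_bound in K. lia.
  - simpl in B. lia.
Qed.

(** One step of the Henkin construction. Free variables serve as witnesses instead of new constants:
    the theory consists of sentences and [G] is finite, so a fresh variable is always available. *)
Definition extend (G : list form) (p : form) : list form :=
  if excluded_middle_informative (con (p :: G)) then
    match p with
    | fEx x q => subst x (tvar (lbound (p :: G))) q :: p :: G
    | _ => p :: G
    end
  else G.

Variable goal : form.
Hypothesis not_provable : ~ proves A goal.

(** Starting from the negated goal makes the resulting model refute the goal. *)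
Fixpoint stage (n : nat) : list form :=
  match n with
  | 0 => [fNot goal]
  | S n => extend (stage n) (fdecode n)
  end.

Lemma extend_incl G p : incl G (extend G p).
Proof.
  unfold extend. destruct excluded_middle_informative; [|apply incl_refl].
  intros r Hr. destruct p; simpl; auto.
Qed.

Lemma extend_con G p : con G -> con (extend G p).
Proof.
  unfold extend. intro C. destruct excluded_middle_informative as [K|K]; auto.
  destruct p; auto. apply con_witness; auto.
Qed.

Lemma stage_con n : con (stage n).
Proof.
  induction n; simpl; [|apply extend_con; auto].
  intros [p [H K]]. apply not_provable.
  assert (L : der [] (fNot (fNot goal))) by (apply (der_notI _ _ p); auto).
  destruct L as [X [XA XP]]. exists X. split; auto.
  rewrite app_nil_r in XP. apply prv_dn; auto.
Qed.

Lemma stage_incl m n : m <= n -> incl (stage m) (stage n).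
Proof.
  induction 1; [apply incl_refl|]. simpl. eapply incl_tran; eauto using extend_incl.
Qed.

Definition mcs (p : form) : Prop := exists n, In p (stage n).

Lemma mcs_stage p : con (p :: stage (fcode p)) -> In p (stage (S (fcode p))).
Proof.
  intro C. simpl. rewrite fdecode_code. unfold extend.
  destruct excluded_middle_informative; [|tauto]. destruct p; simpl; auto.
Qed.

(** If [p] is inconsistent with the stage at which it is considered, that stage derives its
    negation, and a later stage would derive both. *)
Lemma mcs_der n p : der (stage n) p -> mcs p.
Proof.
  intro H. destruct (classic (con (p :: stage (fcode p)))) as [C|C].
  - exists (S (fcode p)). apply mcs_stage; auto.
  - exfalso. apply con_add_not in C. apply (stage_con (max n (fcode p))).
    exists p. split; (eapply der_mono; [|eassumption]); apply stage_incl; lia.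
Qed.

Lemma mcs_merge p q r : (forall G, prv G p -> prv G q -> prv G r) -> mcs p -> mcs q -> mcs r.
Proof.
  intros R [m Hm] [n Hn]. apply (mcs_der (max m n)). apply (der_merge _ p q); auto.
  - apply der_ax. apply (stage_incl m); [lia|auto].
  - apply der_ax. apply (stage_incl n); [lia|auto].
Qed.

Lemma mcs_map p r : (forall G, prv G p -> prv G r) -> mcs p -> mcs r.
Proof. intros R H. apply (mcs_merge p p); auto. Qed.

Lemma mcs_prv p : prv [] p -> mcs p.
Proof.
  intro H. apply (mcs_der 0). exists []. split; [simpl; tauto|].
  eapply prv_weak; [|exact H]. intros x [].
Qed.

Lemma mcs_theory p : A p -> mcs p.
Proof. intro H. apply (mcs_der 0), der_theory; auto. Qed.

Lemma mcs_not p : mcs (fNot p) <-> ~ mcs p.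
Proof.
  split.
  - intros [m Hm] [n Hn]. apply (stage_con (max m n)). exists p.
    split; apply der_ax; [apply (stage_incl n)|apply (stage_incl m)]; auto; lia.
  - intro N. destruct (classic (con (p :: stage (fcode p)))) as [C|C].
    + destruct N. exists (S (fcode p)). apply mcs_stage; auto.
    + apply con_add_not in C. eapply mcs_der; eauto.
Qed.

(** The existential formula is consistent with the stage that considers it, as both lie in some
    later stage, so [extend] adds its witness there. The bound on [y] ensures that [y] is
    substitutable in [q]. *)
Lemma mcs_witness x q : mcs (fEx x q) -> exists y, fbound q <= y /\ mcs (subst x (tvar y) q).
Proof.
  intros [m Hm]. set (n := fcode (fEx x q)).
  assert (C : con (fEx x q :: stage n)).
  { intros [r [H K]]. apply (stage_con (max m n)). exists r.
    assert (I : incl (fEx x q :: stage n) (stage (max m n))).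
    { intros s [<-|Hs]; [apply (stage_incl m)|apply (stage_incl n)]; auto; lia. }
    split; eapply der_mono; eauto. }
  exists (lbound (fEx x q :: stage n)). split; [simpl; lia|].
  exists (S n). cbn [stage]. 
  rewrite (fdecode_code _ : fdecode n = fEx x q). unfold extend.
  destruct excluded_middle_informative; [|tauto]. left. reflexivity.
Qed.

(** * The term model and the truth lemma *)

Definition eqv (s t : term) : Prop := mcs (fEq s t).

Lemma eqv_refl t : eqv t t.
Proof. apply mcs_prv, prv_eq_refl. Qed.

Lemma eqv_subst x p s t :
  free_for s x p -> free_for t x p -> eqv s t -> mcs (subst x s p) -> mcs (subst x t p).
Proof. intros H K. apply mcs_merge. intros G E P. apply (prv_eq_subst G x p s t); auto. Qed.

Lemma tbound_not_free t x : tbound t <= x -> ~ In x (tfv t).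
Proof. intros H K. apply tfv_bound in K. lia. Qed.

Lemma tsubst_var x u : tsubst x u (tvar x) = u.
Proof. simpl. destruct Nat.eq_dec; congruence. Qed.

Lemma eqv_sym s t : eqv s t -> eqv t s.
Proof.
  intro H. set (x := tbound s).
  pose proof (eqv_subst x (fEq (tvar x) s) s t I I H) as K. cbn [subst] in K.
  rewrite !tsubst_var, !tsubst_not_free in K by (apply tbound_not_free; unfold x; lia).
  apply K, eqv_refl.
Qed.

Lemma eqv_trans s t u : eqv s t -> eqv t u -> eqv s u.
Proof.
  intros H1 H2. set (x := tbound s).
  pose proof (eqv_subst x (fEq s (tvar x)) t u I I H2) as K. cbn [subst] in K.
  rewrite !tsubst_var, !tsubst_not_free in K by (apply tbound_not_free; unfold x; lia).
  apply K; auto.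
Qed.

(** Leibniz substitution applied to the equation between [C s] and [C x], with [x] fresh for [C s];
    the instance at [s] is reflexivity. *)
Lemma eqv_congr (C : term -> term) x s t :
  (forall u, tsubst x u (C (tvar x)) = C u) -> tbound (C s) <= x ->
  eqv s t -> eqv (C s) (C t).
Proof.
  intros HC B H.
  pose proof (eqv_subst x (fEq (C s) (C (tvar x))) s t I I H) as K. cbn [subst] in K.
  rewrite !HC, !tsubst_not_free in K by (apply tbound_not_free; lia).
  apply K, eqv_refl.
Qed.

Lemma eqv_succ s t : eqv s t -> eqv (tsucc s) (tsucc t).
Proof.
  apply (eqv_congr tsucc (tbound s)); [|simpl; lia].
  intro u. cbn [tsubst]. destruct Nat.eq_dec; congruence.
Qed.

Lemma eqv_bin (op : term -> term -> term) :
  (forall x u s t, tsubst x u (op s t) = op (tsubst x u s) (tsubst x u t)) ->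
  (forall s t, tbound (op s t) = max (tbound s) (tbound t)) ->
  forall s s' t t', eqv s s' -> eqv t t' -> eqv (op s t) (op s' t').
Proof.
  intros Hs Hb s s' t t' H K. apply eqv_trans with (op s' t).
  - apply (eqv_congr (fun u => op u t) (max (tbound s) (tbound t))); auto.
    + intro u. rewrite Hs, tsubst_var, tsubst_not_free; auto. apply tbound_not_free; lia.
    + rewrite Hb; lia.
  - apply (eqv_congr (fun u => op s' u) (max (tbound s') (tbound t))); auto.
    + intro u. rewrite Hs, tsubst_var, tsubst_not_free; auto. apply tbound_not_free; lia.
    + rewrite Hb; lia.
Qed.

(** The quotient of the terms by provable equality, with classes represented as predicates; [rep]
    picks a member of a class by description. *)
Definition class : Type := {P : term -> Prop | exists t, P = eqv t}.

Definition mk (t : term) : class := exist _ (eqv t) (ex_intro _ t eq_refl).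

Definition rep (d : class) : term :=
  proj1_sig (constructive_indefinite_description _ (proj2_sig d)).

Lemma mk_eq s t : mk s = mk t <-> eqv s t.
Proof.
  split; intro H.
  - injection H; intro E. rewrite E. apply eqv_refl.
  - unfold mk. assert (E : eqv s = eqv t).
    { apply functional_extensionality; intro u. apply propositional_extensionality.
      split; intro K; eapply eqv_trans; eauto using eqv_sym. }
    apply subset_eq_compat. auto.
Qed.

Lemma mk_rep d : mk (rep d) = d.
Proof.
  unfold rep. destruct constructive_indefinite_description as [t Ht]; simpl.
  destruct d as [P HP]. simpl in Ht. apply subset_eq_compat. auto.
Qed.

Lemma rep_mk t : eqv (rep (mk t)) t.
Proof. apply mk_eq, mk_rep. Qed.

Definition term_model : structure :=
  Structure class (mk tzero) (fun d => mk (tsucc (rep d)))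
    (fun d e => mk (tadd (rep d) (rep e))) (fun d e => mk (tmul (rep d) (rep e)))
    (fun d => mcs (fT (rep d))).

Definition canon (x : nat) : term_model := mk (tvar x).

Lemma eval_canon t : eval term_model canon t = mk t.
Proof.
  induction t; cbn [eval].
  - reflexivity.
  - reflexivity.
  - rewrite IHt. apply mk_eq, eqv_succ, rep_mk.
  - rewrite IHt1, IHt2. apply mk_eq, (eqv_bin tadd); auto using rep_mk.
  - rewrite IHt1, IHt2. apply mk_eq, (eqv_bin tmul); auto using rep_mk.
Qed.

Lemma mcs_T s t : eqv s t -> mcs (fT s) -> mcs (fT t).
Proof.
  intros H K. pose proof (eqv_subst 0 (fT (tvar 0)) s t I I H) as L.
  cbn [subst] in L. rewrite !tsubst_var in L. auto.
Qed.

(* The conjunct [fEq _ _] on the bound [n] is a dummy forcing the witness above [n]. *)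
Lemma fresh_name d n : exists y, n <= y /\ d = canon y.
Proof.
  set (t := rep d). set (x := tbound t).
  set (q := fAnd (fEq (tvar x) t) (fEq (tvar n) (tvar n))).
  assert (H : mcs (fEx x q)).
  { apply mcs_prv. apply prv_exI with t; [simpl; auto|]. unfold q. cbn [subst].
    rewrite tsubst_var, tsubst_not_free by (apply tbound_not_free; unfold x; lia).
    apply prv_andI; apply prv_eq_refl. }
  apply mcs_witness in H. destruct H as [y [B H]]. exists y. split; [simpl in B; lia|].
  rewrite <- (mk_rep d). apply mk_eq, eqv_sym.
  revert H. unfold q. cbn [subst].
  rewrite tsubst_var, (tsubst_not_free x _ t) by (apply tbound_not_free; unfold x; lia).
  apply mcs_map. intros G. apply prv_andE1.
Qed.

Lemma prv_all_of_not_ex_not G x p : prv G (fNot (fEx x (fNot p))) -> prv G (fAll x p).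
Proof.
  intro H. eapply prv_cut; [exact H|].
  (* [G] may contain [x] free; it is discarded because the one remaining hypothesis binds [x], as
     generalisation requires. *)
  apply prv_weak with [fNot (fEx x (fNot p))]; [intros r [<-|[]]; simpl; auto|].
  apply prv_allI.
  - intros q [<-|[]]. simpl. apply remove_In.
  - apply prv_dn. apply prv_notI with (fEx x (fNot p)).
    + apply prv_exI with (tvar x).
      * apply free_for_self, incl_refl.
      * replace (subst x (tvar x) (fNot p)) with (fNot p); [apply prv_ax; simpl; auto|].
        clear. assert (T : forall t, tsubst x (tvar x) t = t).
        { induction t; simpl; try congruence. destruct Nat.eq_dec; congruence. }
        simpl. f_equal.
        induction p; simpl; rewrite ?T; try congruence; destruct Nat.eq_dec; congruence.
    + apply prv_ax; simpl; auto.
Qed.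

(** Induction on a bound for the size. In the quantifier cases [fresh_name] gives each element of
    the model a variable name too large to be captured, so that quantification over elements becomes
    quantification over substitution instances. *)
Lemma truth n : forall p, fsize p < n -> (sat term_model canon p <-> mcs p).
Proof.
  induction n as [|n IH]; intros p Hp; [lia|].
  destruct p as [s t|t|p|p q|p q|x p|x p]; simpl in Hp.
  - cbn [sat]. rewrite !eval_canon. apply mk_eq.
  - cbn [sat]. rewrite eval_canon. simpl. split; apply mcs_T; auto using rep_mk, eqv_sym.
  - cbn [sat]. rewrite IH by lia. rewrite mcs_not. tauto.
  - rewrite sat_or, !IH by lia. split.
    + intros [H|H]; revert H; apply mcs_map; intros G; [apply prv_orI1|apply prv_orI2].
    + intro H. apply NNPP. intro N. apply not_or_and in N. destruct N as [N1 N2].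
      apply mcs_not in N1. apply mcs_not in N2.
      assert (K : mcs (fAnd (fNot p) (fNot q))).
      { eapply mcs_merge; [|exact N1|exact N2]. intros; apply prv_andI; auto. }
      assert (L : mcs (fNot (fOr p q))); [|apply mcs_not in L; auto].
      eapply mcs_merge; [|exact H|exact K]. intros G E F.
      eapply prv_orE; [exact E| |].
      * apply prv_notE with p; [apply prv_ax; simpl; auto|].
        apply prv_weak with G; [apply incl_tl, incl_refl|]. eapply prv_andE1; eauto.
      * apply prv_notE with q; [apply prv_ax; simpl; auto|].
        apply prv_weak with G; [apply incl_tl, incl_refl|]. eapply prv_andE2; eauto.
  - cbn [sat]. rewrite !IH by lia. split.
    + intros [H K]. eapply mcs_merge; [|exact H|exact K]. intros; apply prv_andI; auto.
    + intro H. split; revert H; apply mcs_map; intros G; [apply prv_andE1|apply prv_andE2].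
  - cbn [sat]. split.
    + intros [d Hd]. destruct (fresh_name d (fbound p)) as [y [B ->]].
      assert (F := free_for_fresh y x p B).
      apply (sat_subst term_model x (tvar y) p canon F) in Hd. apply IH in Hd; [|rewrite fsize_subst; lia].
      revert Hd. apply mcs_map. intros G. apply prv_exI; auto.
    + intro H. apply mcs_witness in H. destruct H as [y [B H]].
      apply IH in H; [|rewrite fsize_subst; lia].
      apply sat_subst in H; [|apply free_for_fresh; auto]. eexists; exact H.
  - cbn [sat]. split.
    + intro H. apply NNPP. intro N. apply mcs_not in N.
      assert (K : mcs (fEx x (fNot p))).
      { apply NNPP. intro K. apply mcs_not in K. apply mcs_not in N. apply N.
        revert K. apply mcs_map. intros G. apply prv_all_of_not_ex_not. }
      apply mcs_witness in K. destruct K as [y [B K]]. simpl in B, K.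
      apply mcs_not in K. apply K. apply IH; [rewrite fsize_subst; lia|].
      apply sat_subst; [apply free_for_fresh; auto|]. apply H.
    + intros H d. destruct (fresh_name d (fbound p)) as [y [B ->]].
      assert (F := free_for_fresh y x p B).
      apply (sat_subst term_model x (tvar y) p canon F).
      apply IH; [rewrite fsize_subst; lia|]. revert H. apply mcs_map.
      intros G. apply prv_allE; auto.
Qed.

End Henkin.

Theorem completeness (A : theory) (p : form) :
  (forall q, A q -> fv q = []) ->
  (forall (M : structure) (r : nat -> M), (forall q r', A q -> sat M r' q) -> sat M r p) ->
  proves A p.
Proof.
  intros C H. apply NNPP. intro N.
  assert (Tr := fun q => truth A C p N (S (fsize q)) q (Nat.lt_succ_diag_r _)).
  assert (K : mcs A p (fNot p)) by (exists 0; simpl; auto).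
  apply mcs_not in K; auto. apply K, Tr. apply H.
  (* An axiom is a sentence, so its truth does not depend on the assignment. *)
  intros q r' Hq. rewrite (sat_ext _ q r' (canon A p)); [|rewrite C by auto; simpl; tauto].
  apply Tr, mcs_theory; auto.
Qed.

(** * Definability with parameters *)

Lemma sat_closure M p : (forall r, sat M r (closure p)) -> forall r, sat M r p.
Proof.
  unfold closure. induction (fv p) as [|x l IH]; simpl; auto.
  intros H. apply IH. intro r. specialize (H r (r x)).
  replace (upd r x (r x)) with r in H; auto.
  apply functional_extensionality; intro y; unfold upd; destruct Nat.eq_dec; congruence.
Qed.

Section Definability.

Variable M : structure.

Fixpoint vec (n : nat) : Type :=
  match n with 0 => unit | S n => (vec n * M)%type end.

(* Variables with even names hold the arguments, those with odd names the
   parameters; a parameter list may be stored from any position [k] on, so that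
   the lists of two formulas can be put side by side. *)
Fixpoint holds_args (n : nat) : vec n -> (nat -> M) -> Prop :=
  match n with
  | 0 => fun _ _ => True
  | S n => fun v r => holds_args n (fst v) r /\ r (2 * n) = snd v
  end.

Definition holds_params (ps : list M) (k : nat) (r : nat -> M) : Prop :=
  forall i, i < length ps -> r (S (2 * (k + i))) = nth i ps (zr M).

Definition Dterm (n : nat) (f : vec n -> M) : Prop :=
  exists ps, forall k, exists t, forall r v,
    holds_params ps k r -> holds_args n v r -> eval M r t = f v.

(** The defining formula must be arithmetical, because induction is available for such formulas
    only. *)
Definition Dform (n : nat) (P : vec n -> Prop) : Prop :=
  exists ps, forall k, exists p, arith p /\ forall r v,
    holds_params ps k r -> holds_args n v r -> (sat M r p <-> P v).

Lemma holds_params_app ps qs k r : holds_params (ps ++ qs) k r ->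
  holds_params ps k r /\ holds_params qs (k + length ps) r.
Proof.
  unfold holds_params. rewrite length_app. intro H. split; intros i Hi.
  - rewrite H by lia. apply app_nth1; auto.
  - replace (k + length ps + i) with (k + (length ps + i)) by lia.
    rewrite H, app_nth2 by lia. f_equal. lia.
Qed.

Lemma holds_args_upd n v r m d : n <= m -> holds_args n v r -> holds_args n v (upd r (2 * m) d).
Proof.
  induction n; cbn [holds_args]; auto. intros H [K L]. split; [apply IHn; auto; lia|].
  rewrite upd_neq by lia. auto.
Qed.

Lemma holds_params_upd ps k r m d : holds_params ps k r -> holds_params ps k (upd r (2 * m) d).
Proof. intros H i Hi. rewrite upd_neq by lia. auto. Qed.

Lemma Dterm_const n a : Dterm n (fun _ => a).
Proof.
  exists [a]. intro k. exists (tvar (S (2 * k))). intros r v H _. specialize (H 0 (Nat.lt_0_1)).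
  rewrite Nat.add_0_r in H. exact H.
Qed.

Lemma Dterm_last n : Dterm (S n) (fun v => snd v).
Proof. exists []. intro k. exists (tvar (2 * n)). intros r v _ [_ H]. exact H. Qed.

Lemma Dterm_weaken n f g : (forall v d, g (v, d) = f v) -> Dterm n f -> Dterm (S n) g.
Proof.
  intros E [ps H]. exists ps. intro k. destruct (H k) as [t Ht]. exists t.
  intros r [v d] Hp [Ha _]. rewrite E. apply Ht; auto.
Qed.

Lemma Dterm_sc n f : Dterm n f -> Dterm n (fun v => sc M (f v)).
Proof.
  intros [ps H]. exists ps. intro k. destruct (H k) as [t Ht]. exists (tsucc t).
  intros r v Hp Ha. simpl. rewrite (Ht r v); auto.
Qed.

Lemma Dterm_bin (top : term -> term -> term) (op : M -> M -> M) :
  (forall r s t, eval M r (top s t) = op (eval M r s) (eval M r t)) ->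
  forall n f g, Dterm n f -> Dterm n g -> Dterm n (fun v => op (f v) (g v)).
Proof.
  intros E n f g [ps H] [qs K]. exists (ps ++ qs). intro k.
  destruct (H k) as [s Hs], (K (k + length ps)) as [t Ht]. exists (top s t).
  intros r v Hp Ha. apply holds_params_app in Hp. destruct Hp.
  rewrite E, (Hs r v), (Ht r v); auto.
Qed.

Lemma Dterm_ad n f g : Dterm n f -> Dterm n g -> Dterm n (fun v => ad M (f v) (g v)).
Proof. apply (Dterm_bin tadd); reflexivity. Qed.

Lemma Dterm_mu n f g : Dterm n f -> Dterm n g -> Dterm n (fun v => mu M (f v) (g v)).
Proof. apply (Dterm_bin tmul); reflexivity. Qed.

Lemma Dform_eq n f g : Dterm n f -> Dterm n g -> Dform n (fun v => f v = g v).
Proof.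
  intros [ps H] [qs K]. exists (ps ++ qs). intro k.
  destruct (H k) as [s Hs], (K (k + length ps)) as [t Ht]. exists (fEq s t).
  split; [exact I|]. intros r v Hp Ha. apply holds_params_app in Hp. destruct Hp.
  simpl. rewrite (Hs r v), (Ht r v); tauto.
Qed.

Lemma Dform_not n P : Dform n P -> Dform n (fun v => ~ P v).
Proof.
  intros [ps H]. exists ps. intro k. destruct (H k) as [p [Hp1 Hp2]]. exists (fNot p).
  split; [exact Hp1|]. intros r v Hp Ha. simpl. rewrite (Hp2 r v); tauto.
Qed.

Lemma Dform_bin (fop : form -> form -> form) (op : Prop -> Prop -> Prop) :
  (forall p q, arith p -> arith q -> arith (fop p q)) ->
  (forall r p q P Q, (sat M r p <-> P) -> (sat M r q <-> Q) -> (sat M r (fop p q) <-> op P Q)) ->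
  forall n P Q, Dform n P -> Dform n Q -> Dform n (fun v => op (P v) (Q v)).
Proof.
  intros E F n P Q [ps H] [qs K]. exists (ps ++ qs). intro k.
  destruct (H k) as [p [Hp1 Hp2]], (K (k + length ps)) as [q [Hq1 Hq2]]. exists (fop p q).
  split; [auto|]. intros r v Hp Ha. apply holds_params_app in Hp. destruct Hp.
  apply F; auto.
Qed.

Lemma Dform_and n P Q : Dform n P -> Dform n Q -> Dform n (fun v => P v /\ Q v).
Proof. apply (Dform_bin fAnd); simpl; tauto. Qed.

Lemma Dform_or n P Q : Dform n P -> Dform n Q -> Dform n (fun v => P v \/ Q v).
Proof.
  apply (Dform_bin fOr); [simpl; tauto|]. intros. rewrite sat_or. tauto.
Qed.

Lemma Dform_imp n P Q : Dform n P -> Dform n Q -> Dform n (fun v => P v -> Q v).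
Proof. apply (Dform_bin fImp (fun P Q => P -> Q)); simpl; tauto. Qed.

Lemma Dform_ex n (P : vec n -> M -> Prop) :
  Dform (S n) (fun w => P (fst w) (snd w)) -> Dform n (fun v => exists d, P v d).
Proof.
  intros [ps H]. exists ps. intro k. destruct (H k) as [p [Hp1 Hp2]]. exists (fEx (2 * n) p).
  split; [exact Hp1|]. intros r v Hp Ha. cbn [sat].
  split; intros [d Hd]; exists d; revert Hd; apply (Hp2 (upd r (2 * n) d) (v, d));
    auto using holds_params_upd;
    (split; [apply holds_args_upd; auto | apply upd_eq]).
Qed.

Lemma Dform_all n (P : vec n -> M -> Prop) :
  Dform (S n) (fun w => P (fst w) (snd w)) -> Dform n (fun v => forall d, P v d).
Proof.
  intros [ps H]. exists ps. intro k. destruct (H k) as [p [Hp1 Hp2]]. exists (fAll (2 * n) p).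
  split; [exact Hp1|]. intros r v Hp Ha. cbn [sat].
  split; intros Hd d; generalize (Hd d); apply (Hp2 (upd r (2 * n) d) (v, d));
    auto using holds_params_upd;
    (split; [apply holds_args_upd; auto | apply upd_eq]).
Qed.

(** This turns the induction scheme into a second-order looking principle for definable predicates
    of the model, so that later inductions need not write formulas. *)
Lemma definable_induction (HPA : forall q r, PA q -> sat M r q) (P : M -> Prop) :
  Dform 1 (fun v => P (snd v)) ->
  P (zr M) -> (forall d, P d -> P (sc M d)) -> forall d, P d.
Proof.
  intros [ps H] P0 PS d. destruct (H 0) as [p [Hp1 Hp2]].
  (* Variable [2 * i + 1] receives the parameter with index [i]; variable 0, the induction variable,
     is overwritten by [upd]. *)
  set (r := fun n => nth (Nat.div2 n) ps (zr M)).
  assert (E : forall d, sat M (upd r 0 d) p <-> P d).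
  { intro a. apply (Hp2 _ (tt, a)).
    - apply (holds_params_upd ps 0 r 0). intros i Hi. unfold r. simpl (0 + i).
      f_equal. apply Nat.div2_succ_double.
    - split; [exact I|]. apply upd_eq. }
  assert (K := sat_closure M _ (fun r => HPA _ r (PA_induction 0 p Hp1)) r).
  apply E. revert d. apply K. split.
  - apply sat_subst; [apply free_for_self; simpl; intros ? []|]. apply E; auto.
  - intros d Hd. apply E in Hd. apply sat_subst; [apply free_for_self, incl_refl|].
    simpl. rewrite upd_upd. apply E. rewrite upd_eq. auto.
Qed.

End Definability.

(** A hook for [definable], redefined whenever new notions have been shown definable. *)
Ltac definable_lemma := fail.

Ltac definable :=
  cbv beta;
  lazymatch goal with
  | |- Dterm _ _ snd => apply Dterm_last
  | |- Dterm _ _ (fun v => snd v) => apply Dterm_last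
  | |- Dterm _ _ (fun _ => ?a) => apply Dterm_const
  | |- Dterm _ _ (fun v => sc _ _) => apply Dterm_sc; definable
  | |- Dterm _ _ (fun v => ad _ _ _) => apply Dterm_ad; definable
  | |- Dterm _ _ (fun v => mu _ _ _) => apply Dterm_mu; definable
  | |- Dform _ _ (fun v => _ = _) => apply Dform_eq; definable
  | |- Dform _ _ (fun v => _ /\ _) => apply Dform_and; definable
  | |- Dform _ _ (fun v => _ \/ _) => apply Dform_or; definable
  | |- Dform _ _ (fun v => ~ _) => apply Dform_not; definable
  | |- Dform _ _ (fun v => exists d, _) => apply Dform_ex; definable
  (* Quantification over the model also has this shape; it is left to [Dform_all]. *)
  | |- Dform _ _ (fun v => _ -> _) => first [apply Dform_imp | apply Dform_all]; definable
  | |- _ =>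
      first [ assumption
            | definable_lemma; definable
            | eapply Dterm_weaken; [intros ? ?; cbn [fst snd]; reflexivity | definable] ]
  end.

(** * Arithmetic in a model of PA *)

Declare Scope model_scope.
Delimit Scope model_scope with M.

Section Model.

Variable M : structure.
Hypothesis HPA : forall q r, PA q -> sat M r q.

Local Notation "0" := (zr M) : model_scope.
Local Notation "1" := (sc M (zr M)) : model_scope.
Local Notation "'σ' x" := (sc M x) (at level 9, x at level 9) : model_scope.
Local Notation "x + y" := (ad M x y) : model_scope.
Local Notation "x * y" := (mu M x y) : model_scope.
Local Open Scope model_scope.

Let r0 : nat -> M := fun _ => 0.

Lemma sc_neq_0 x : σ x <> 0.
Proof. exact (HPA _ r0 PA_succ_neq0 x). Qed.

Lemma sc_inj x y : σ x = σ y -> x = y.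
Proof. exact (HPA _ r0 PA_succ_inj x y). Qed.

Lemma add_0_r x : x + 0 = x.
Proof. exact (HPA _ r0 PA_add0 x). Qed.

Lemma add_sc_r x y : x + σ y = σ (x + y).
Proof. exact (HPA _ r0 PA_addS x y). Qed.

Lemma mul_0_r x : x * 0 = 0.
Proof. exact (HPA _ r0 PA_mul0 x). Qed.

Lemma mul_sc_r x y : x * σ y = x * y + x.
Proof. exact (HPA _ r0 PA_mulS x y). Qed.

Ltac model_induction x :=
  pattern x; revert x; apply (definable_induction M HPA);
  [definable | | intros x IH].

Lemma add_0_l x : 0 + x = x.
Proof.
  model_induction x.
  - apply add_0_r.
  - rewrite add_sc_r, IH. reflexivity.
Qed.

Lemma add_sc_l x y : σ x + y = σ (x + y).
Proof.
  model_induction y.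
  - rewrite !add_0_r. reflexivity.
  - rewrite !add_sc_r, IH. reflexivity.
Qed.

Lemma add_comm x y : x + y = y + x.
Proof.
  model_induction y.
  - rewrite add_0_r, add_0_l. reflexivity.
  - rewrite add_sc_r, add_sc_l, IH. reflexivity.
Qed.

Lemma add_assoc x y z : x + (y + z) = (x + y) + z.
Proof.
  model_induction z.
  - rewrite !add_0_r. reflexivity.
  - rewrite !add_sc_r, IH. reflexivity.
Qed.

Lemma mul_0_l x : 0 * x = 0.
Proof.
  model_induction x.
  - apply mul_0_r.
  - rewrite mul_sc_r, IH. apply add_0_r.
Qed.

Lemma mul_sc_l x y : σ x * y = x * y + y.
Proof.
  model_induction y.
  - rewrite !mul_0_r, add_0_r. reflexivity.
  - rewrite !mul_sc_r, IH, !add_sc_r. f_equal.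
    rewrite <- !add_assoc. f_equal. apply add_comm.
Qed.

Lemma mul_comm x y : x * y = y * x.
Proof.
  model_induction y.
  - rewrite mul_0_r, mul_0_l. reflexivity.
  - rewrite mul_sc_r, mul_sc_l, IH. reflexivity.
Qed.

Lemma mul_add_l x y z : (x + y) * z = x * z + y * z.
Proof.
  model_induction z.
  - rewrite !mul_0_r, add_0_r. reflexivity.
  - rewrite !mul_sc_r, IH, <- !add_assoc. f_equal.
    rewrite !add_assoc. f_equal. apply add_comm.
Qed.

Lemma mul_assoc x y z : x * (y * z) = (x * y) * z.
Proof.
  model_induction x.
  - rewrite !mul_0_l. reflexivity.
  - rewrite !mul_sc_l, IH, mul_add_l. reflexivity.
Qed.

Lemma mul_1_l x : 1 * x = x.
Proof. rewrite mul_sc_l, mul_0_l, add_0_l. reflexivity. Qed.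

Lemma model_semi_ring : semi_ring_theory 0 1 (ad M) (mu M) eq.
Proof.
  constructor; auto using add_0_l, add_comm, add_assoc, mul_1_l, mul_0_l, mul_comm,
    mul_assoc, mul_add_l.
Qed.

Add Ring model_ring : model_semi_ring.

Lemma sc_add_1 x : σ x = x + 1.
Proof. rewrite add_sc_r, add_0_r. reflexivity. Qed.

(** The semiring has no successor, so [σ x] becomes [x + 1]. The unit is itself [σ 0] and has to be
    spared, or the rewriting would not end. *)
Ltac mring :=
  repeat match goal with
  | |- context [sc M ?x] => lazymatch x with zr M => fail | _ => rewrite (sc_add_1 x) end
  end; ring.

Lemma add_cancel_l x y z : x + y = x + z -> y = z.
Proof.
  model_induction x.
  - rewrite !add_0_l. auto.
  - rewrite !add_sc_l. intro H. apply IH, sc_inj, H.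
Qed.

Lemma zero_or_sc x : x = 0 \/ exists y, x = σ y.
Proof. model_induction x; eauto. Qed.

Lemma add_eq_0 x y : x + y = 0 -> y = 0.
Proof.
  destruct (zero_or_sc y) as [->|[z ->]]; auto.
  rewrite add_sc_r. intro H. destruct (sc_neq_0 _ H).
Qed.

Lemma add_sc_neq x z : x + σ z <> x.
Proof.
  intro H. apply (sc_neq_0 z), (add_cancel_l x). rewrite add_0_r. exact H.
Qed.

(** * The order of the model *)

Definition lt (x y : M) : Prop := exists z, x + σ z = y.

Lemma Dform_lt n f g : Dterm M n f -> Dterm M n g -> Dform M n (fun v => lt (f v) (g v)).
Proof. intros. unfold lt. definable. Qed.

Ltac definable_lemma ::= apply Dform_lt.

Lemma lt_sc x : lt x (σ x).
Proof. exists 0. mring. Qed.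

Lemma lt_0_sc x : lt 0 (σ x).
Proof. exists x. mring. Qed.

Lemma not_lt_0 x : ~ lt x 0.
Proof. intros [z H]. apply add_eq_0 in H. destruct (sc_neq_0 _ H). Qed.

Lemma lt_trans x y z : lt x y -> lt y z -> lt x z.
Proof. intros [a <-] [b <-]. exists (a + σ b). mring. Qed.

Lemma lt_irrefl x : ~ lt x x.
Proof. intros [z H]. destruct (add_sc_neq _ _ H). Qed.

Lemma lt_sc_iff x y : lt x (σ y) <-> lt x y \/ x = y.
Proof.
  split.
  - intros [z H]. rewrite add_sc_r in H. apply sc_inj in H.
    destruct (zero_or_sc z) as [->|[w ->]].
    + right. rewrite <- H. mring.
    + left. exists w. exact H.
  - intros [H|<-]; [|apply lt_sc]. apply lt_trans with y; auto using lt_sc.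
Qed.

Lemma lt_sc_sc x y : lt (σ x) (σ y) <-> lt x y.
Proof.
  split; intros [z H]; exists z.
  - rewrite add_sc_l in H. apply sc_inj; auto.
  - rewrite <- H. mring.
Qed.

Lemma lt_total x y : lt x y \/ x = y \/ lt y x.
Proof.
  model_induction x.
  - destruct (zero_or_sc y) as [->|[w ->]]; auto using lt_0_sc.
  - destruct IH as [[z H]|[->|H]].
    + destruct (zero_or_sc z) as [->|[w ->]].
      * right; left. rewrite <- H. mring.
      * left. exists w. rewrite <- H. mring.
    + right; right. apply lt_sc.
    + right; right. apply lt_trans with x; auto using lt_sc.
Qed.

Lemma lt_add_cases i l k : lt i (l + k) -> lt i l \/ exists j, lt j k /\ i = l + j.
Proof.
  intro H. destruct (lt_total i l) as [K|[->|[z <-]]]; auto; right.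
  - exists 0. split; [|mring]. destruct H as [w H]. apply add_cancel_l in H. exists w.
    rewrite <- H. mring.
  - exists (σ z). split; auto. destruct H as [w H]. rewrite <- add_assoc in H.
    apply add_cancel_l in H. exists w. exact H.
Qed.

Lemma lt_add_l l j k : lt j k -> lt (l + j) (l + k).
Proof. intros [z <-]. exists z. mring. Qed.

(** * Pairing and division with remainder *)

Definition pair (x y : M) : M := (x + y) * (x + y) + x.

Lemma Dterm_pair n f g : Dterm M n f -> Dterm M n g -> Dterm M n (fun v => pair (f v) (g v)).
Proof. intros. unfold pair. definable. Qed.

(** With [s = x + y], the code is at most [s * s + s], which is below the square of any number
    exceeding [s]. *)
Lemma pair_lt x y x' y' : lt (x + y) (x' + y') -> pair x y <> pair x' y'.
Proof.
  intros [z H] E. unfold pair in E. rewrite <- H in E.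
  (* The second argument is the predecessor of the difference of the two codes, expanded so that no
     subtraction occurs. *)
  apply (add_sc_neq ((x + y) * (x + y) + x)
    (x + y + y + z + z + (x + y) * z + z * (x + y) + z * z + x')).
  rewrite E at 2. mring.
Qed.

Lemma pair_inj x y x' y' : pair x y = pair x' y' -> x = x' /\ y = y'.
Proof.
  intro H. destruct (lt_total (x + y) (x' + y')) as [K|[K|K]].
  - destruct (pair_lt _ _ _ _ K H).
  - unfold pair in H. rewrite K in H. apply add_cancel_l in H. subst x'.
    split; auto. apply add_cancel_l in K. auto.
  - symmetry in H. destruct (pair_lt _ _ _ _ K H).
Qed.

Lemma division c m : exists q x, c = q * σ m + x /\ lt x (σ m).
Proof.
  model_induction c.
  - exists 0, 0. split; [mring|apply lt_0_sc].
  - destruct IH as [q [x [-> H]]]. apply lt_sc_iff in H. destruct H as [H| ->].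
    + exists q, (σ x). split; [mring|]. apply lt_sc_sc. exact H.
    + exists (σ q), 0. split; [mring|apply lt_0_sc].
Qed.

Lemma remainder_unique m q x q' x' :
  q * m + x = q' * m + x' -> lt x m -> lt x' m -> x = x'.
Proof.
  (* If one quotient exceeds the other by [σ z], cancellation gives [x = m + (z * m + x')], so [x]
     is not below [m]. *)
  assert (A : forall q x z x', q * m + x = (q + σ z) * m + x' -> ~ lt x m).
  { intros a b z b' E [w H]. assert (F : b = m + (z * m + b')).
    { apply (add_cancel_l (a * m)). rewrite E. mring. }
    apply (add_sc_neq m (w + z * m + b')). 
    transitivity (b + σ w); [rewrite F; mring | exact H]. }
  intros E H H'. destruct (lt_total q q') as [[z <-]|[->|[z <-]]].
  - destruct (A _ _ _ _ E H).
  - apply add_cancel_l in E. exact E.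
  - symmetry in E. destruct (A _ _ _ _ E H').
Qed.

(** * Coded sequences *)

Definition beta (c d i x : M) : Prop :=
  (exists q, c = q * σ (σ i * d) + x) /\ lt x (σ (σ i * d)).

Lemma Dform_beta n f g h k :
  Dterm M n f -> Dterm M n g -> Dterm M n h -> Dterm M n k ->
  Dform M n (fun v => beta (f v) (g v) (h v) (k v)).
Proof. intros. unfold beta. definable. Qed.

Ltac definable_lemma ::= first [apply Dform_lt | apply Dform_beta | apply Dterm_pair].

Lemma beta_fun c d i x y : beta c d i x -> beta c d i y -> x = y.
Proof.
  intros [[q E] H] [[q' E'] H']. rewrite E in E'. eapply remainder_unique; eauto.
Qed.

Lemma beta_total c d i : exists x, beta c d i x.
Proof.
  destruct (division c (σ i * d)) as [q [x [E H]]]. exists x. split; eauto.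
Qed.

(** * Chinese remaindering for the beta function *)

Lemma common_multiple l :
  exists m, forall i, lt i l -> exists e, σ m = σ i * e.
Proof.
  model_induction l.
  - exists 0. intros i H. destruct (not_lt_0 _ H).
  (* The successor of this witness is the product of [σ m] and [σ l]. *)
  - destruct IH as [m H]. exists (m * l + m + l). intros i Hi.
    apply lt_sc_iff in Hi. destruct Hi as [Hi| ->].
    + destruct (H i Hi) as [e E]. exists (e * σ l).
      rewrite mul_assoc, <- E. mring.
    + exists (σ m). mring.
Qed.

(** The congruence [a * u = 1] modulo [m], with multiples of [m] on both sides in place of
    subtraction. *)
Definition invertible (a m : M) : Prop := exists u v w, a * u + m * v = 1 + m * w.

Lemma Dform_invertible n f g : Dterm M n f -> Dterm M n g ->
  Dform M n (fun v => invertible (f v) (g v)).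
Proof. intros. unfold invertible. definable. Qed.

Ltac definable_lemma ::=
  first [apply Dform_lt | apply Dform_beta | apply Dterm_pair | apply Dform_invertible].

Lemma invertible_mul a b m : invertible a m -> invertible b m -> invertible (a * b) m.
Proof.
  intros [u [v [w H]]] [u' [v' [w' H']]].
  exists (u * u'), (a * u * v' + v * b * u' + v * m * v'), (w + w' + w * m * w').
  transitivity ((a * u + m * v) * (b * u' + m * v')); [ring|]. rewrite H, H'. ring.
Qed.

(* Put [D = (j+1)d], so that [D = -1] modulo [D + 1]. If [d = (j-i)e], then modulo
   [D + 1] the product of [1 + (i+1)d] and [e(j+1)^2] is [- D^2 = -1]. *)
Lemma moduli_coprime i z e :
  invertible (σ (σ i * (σ z * e))) (σ (σ (i + σ z) * (σ z * e))).
Proof.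
  set (j := i + σ z). set (D := σ j * (σ z * e)). set (X := e * σ j * σ j).
  exists (X * D), (D * D + 1), (X * D + D). unfold X, D, j. mring.
Qed.

(** The hypothesis is a subtraction-free congruence modulo [σ m]; uniqueness of remainders
    identifies the remainder of [c] with the small number [x]. *)
Lemma congruent_remainder c m x v w :
  c + σ m * v = x + σ m * w -> lt x (σ m) -> exists q, c = q * σ m + x.
Proof.
  intros E H. destruct (division c m) as [q [y [-> Hy]]]. exists q. f_equal.
  apply (remainder_unique (σ m) (q + v) y w x); auto.
  transitivity (q * σ m + y + σ m * v); [ring|]. rewrite E. ring.
Qed.

(** A Chinese remainder argument inside the model: new pairwise coprime moduli are fixed by [d'],
    and [c'] is found by adjusting one remainder at a time to the value prescribed by [F]. *)
Lemma beta_extend c d l x : exists c' d',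
  (forall i, lt i l -> exists y, beta c d i y /\ beta c' d' i y) /\ beta c' d' l x.
Proof.
  destruct (common_multiple l) as [m Hm].
  (* The factor [σ m] is divisible by every positive difference of indices up to [l], which makes
     the moduli coprime. The factor [σ (c + x)] makes each modulus exceed all prescribed values,
     since a remainder of [c] is at most [c]. *)
  set (d' := σ m * σ (c + x)).
  set (F := fun i y => (lt i l /\ beta c d i y) \/ (i = l /\ y = x)).
  assert (Ftot : forall i, lt i (σ l) -> exists y, F i y).
  { intros i Hi. apply lt_sc_iff in Hi. destruct Hi as [Hi| ->].
    - destruct (beta_total c d i) as [y Hy]. exists y. left; auto.
    - exists x. right; auto. }
  assert (Flt : forall i y, F i y -> lt y (σ (σ i * d'))).
  { assert (B : forall i y z, y + z = c + x -> lt y (σ (σ i * d'))).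
    { intros i y z E. exists (z + 1 + i * σ (c + x) + σ i * m * σ (c + x)).
      unfold d'. rewrite <- E. mring. }
    intros i y [[Hi [[q E] _]]|[-> ->]].
    - apply (B i y (q * σ (σ i * d) + x)). rewrite E. ring.
    - apply (B l x c). ring. }
  assert (Cop : forall i j, lt i j -> lt j (σ l) ->
    invertible (σ (σ i * d')) (σ (σ j * d'))).
  { intros i j [z <-] Hj. destruct (Hm z) as [e E].
    - apply lt_sc_iff in Hj. assert (K : lt z (i + σ z)) by (exists i; mring).
      destruct Hj as [Hj|Hj]; [apply lt_trans with (i + σ z); auto|congruence].
    - assert (E' : d' = σ z * (e * σ (c + x))) by (unfold d'; rewrite E; ring).
      rewrite E'. apply moduli_coprime. }
  (* After [k] rounds, [c'] has the first [k] prescribed remainders, and [p] is a common multiple of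
     the first [k] moduli that is invertible modulo the others. Adding multiples of [p] to [c']
     therefore keeps the remainders obtained so far. *)
  assert (St : forall k, lt k (σ (σ l)) -> exists c' p,
    (forall i, lt i k -> exists y, F i y /\ exists q, c' = q * σ (σ i * d') + y) /\
    (forall i, lt i k -> exists e, p = σ (σ i * d') * e) /\
    (forall j, lt j (σ l) -> ~ lt j k -> invertible p (σ (σ j * d')))).
  { intro k. unfold F. model_induction k.
    - intros _. exists 0, 1. repeat split.
      + intros i H; destruct (not_lt_0 _ H).
      + intros i H; destruct (not_lt_0 _ H).
      + intros j _ _. exists 1, 0, 0. ring.
    - intro Hk. destruct IH as [c' [p [H1 [H2 H3]]]].
      { apply lt_trans with (σ k); auto using lt_sc. }
      apply (proj1 (lt_sc_sc _ _)) in Hk. destruct (Ftot k Hk) as [y Hy].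
      destruct (H3 k Hk (lt_irrefl k)) as [u [v [w E]]].
      (* Modulo the new modulus [σ (σ k * d')], the factor [σ k * d'] is [-1] and [u] inverts [p].
         Hence [p * t] is congruent to [y - c'], and [c' + p * t] to [y]. *)
      set (t := u * (y + σ k * d' * c')).
      exists (c' + p * t), (p * σ (σ k * d')). repeat split.
      + intros i Hi. apply lt_sc_iff in Hi. destruct Hi as [Hi| ->].
        * destruct (H1 i Hi) as [a [Ha [q Hq]]]. destruct (H2 i Hi) as [e He].
          exists a. split; auto. exists (q + e * t). rewrite He, Hq at 1. ring.
        * exists y. split; [exact Hy|].
          apply (congruent_remainder _ _ _ (v * (y + σ k * d' * c'))
            (c' + w * (y + σ k * d' * c'))); [|apply Flt; exact Hy].
          transitivity (c' + (p * u + σ (σ k * d') * v) * (y + σ k * d' * c'));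
            [unfold t; ring|]. rewrite E. mring.
      + intros i Hi. apply lt_sc_iff in Hi. destruct Hi as [Hi| ->].
        * destruct (H2 i Hi) as [e ->]. exists (e * σ (σ k * d')). ring.
        * exists p. ring.
      + intros j Hj Hjk. assert (Nk : ~ lt j k).
        { intro K. apply Hjk. apply lt_sc_iff; auto. }
        apply invertible_mul; auto. apply Cop; auto.
        destruct (lt_total k j) as [K|[->|K]]; [auto| |tauto].
        destruct Hjk. apply lt_sc. }
  destruct (St (σ l) (lt_sc _)) as [c' [p [H _]]]. exists c', d'. split.
  - intros i Hi. destruct (H i) as [y [Hy Hq]]; [apply lt_sc_iff; auto|].
    exists y. assert (L := Flt i y Hy). destruct Hy as [[_ Hy]|[-> _]].
    + repeat split; auto; apply Hy.
    + destruct (lt_irrefl _ Hi).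
  - destruct (H l (lt_sc l)) as [y [Hy Hq]]. assert (L := Flt l y Hy).
    destruct Hy as [[Hl _]|[_ ->]]; [destruct (lt_irrefl _ Hl)|]. split; auto.
Qed.

Definition has_length (s l : M) : Prop := exists c d, s = pair l (pair c d).

Definition entry (s i x : M) : Prop :=
  exists l c d, s = pair l (pair c d) /\ lt i l /\ beta c d i x.

Definition prior (s i x : M) : Prop := exists j, lt j i /\ entry s j x.

Definition derivation (step : (M -> Prop) -> M -> Prop) (s : M) : Prop :=
  forall i y, entry s i y -> step (prior s i) y.

Definition derivable (step : (M -> Prop) -> M -> Prop) (x : M) : Prop :=
  exists s, derivation step s /\ exists i, entry s i x.

Lemma Dform_has_length n f g :
  Dterm M n f -> Dterm M n g -> Dform M n (fun v => has_length (f v) (g v)).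
Proof. intros. unfold has_length. definable. Qed.

Lemma Dform_entry n f g h : Dterm M n f -> Dterm M n g -> Dterm M n h ->
  Dform M n (fun v => entry (f v) (g v) (h v)).
Proof. intros. unfold entry. definable. Qed.

Ltac definable_lemma ::=
  first [apply Dform_lt | apply Dterm_pair | apply Dform_has_length | apply Dform_entry].

Lemma entry_fun s i x y : entry s i x -> entry s i y -> x = y.
Proof.
  intros [l [c [d [-> [_ H]]]]] [l' [c' [d' [E [_ H']]]]].
  apply pair_inj in E. destruct E as [_ E]. apply pair_inj in E. destruct E as [<- <-].
  eapply beta_fun; eauto.
Qed.

Lemma entry_lt s l i x : has_length s l -> entry s i x -> lt i l.
Proof.
  intros [c [d ->]] [l' [c' [d' [E [H _]]]]]. apply pair_inj in E. destruct E as [<- _]. auto.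
Qed.

Lemma entry_total s l i : has_length s l -> lt i l -> exists x, entry s i x.
Proof.
  intros [c [d ->]] H. destruct (beta_total c d i) as [x Hx]. exists x, l, c, d. auto.
Qed.

Lemma entry_has_length s i x : entry s i x -> exists l, has_length s l.
Proof. intros [l [c [d [-> _]]]]. exists l, c, d. reflexivity. Qed.

Lemma empty_sequence : has_length (pair 0 (pair 0 0)) 0.
Proof. exists 0, 0. reflexivity. Qed.

Lemma sequence_snoc s l x : has_length s l -> exists s', has_length s' (σ l) /\
  (forall i y, entry s i y -> entry s' i y) /\ entry s' l x.
Proof.
  intros [c [d ->]]. destruct (beta_extend c d l x) as [c' [d' [H K]]].
  exists (pair (σ l) (pair c' d')). split; [|split].
  - exists c', d'. reflexivity.
  - intros i y [l' [a [b [E [Hi Hy]]]]].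
    apply pair_inj in E. destruct E as [<- E]. apply pair_inj in E. destruct E as [<- <-].
    destruct (H i Hi) as [z [Hz Hz']]. rewrite (beta_fun _ _ _ _ _ Hy Hz).
    exists (σ l), c', d'. split; [auto|]. split; [apply lt_sc_iff; auto|auto].
  - exists (σ l), c', d'. split; [auto|]. split; [apply lt_sc|auto].
Qed.

Lemma entry_snoc_inv s s' l x : has_length s l -> has_length s' (σ l) ->
  (forall i y, entry s i y -> entry s' i y) -> entry s' l x ->
  forall i y, entry s' i y -> entry s i y \/ (i = l /\ y = x).
Proof.
  intros Hs Hs' E El i y Hy.
  assert (Hi := entry_lt _ _ _ _ Hs' Hy). apply lt_sc_iff in Hi. destruct Hi as [Hi| ->].
  - left. destruct (entry_total s l i Hs Hi) as [z Hz].
    rewrite (entry_fun s' i y z); auto.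
  - right. split; auto. eapply entry_fun; eauto.
Qed.

Lemma sequence_concat s l t k : has_length s l -> has_length t k ->
  exists u, has_length u (l + k) /\ (forall i x, entry s i x -> entry u i x) /\
    (forall j x, entry t j x -> entry u (l + j) x).
Proof.
  intros Hs Ht.
  (* Here [m] is the number of entries of [t] already appended to [s]. *)
  assert (A : forall m, lt m (σ k) -> exists u, has_length u (l + m) /\
    (forall i x, entry s i x -> entry u i x) /\
    (forall j x, lt j m -> entry t j x -> entry u (l + j) x)).
  { intro m. model_induction m.
    - intros _. exists s. rewrite add_0_r. repeat split; auto.
      intros j x H. destruct (not_lt_0 _ H).
    - intro Hm. apply (proj1 (lt_sc_sc _ _)) in Hm.
      destruct IH as [u [H1 [H2 H3]]]; [apply lt_sc_iff; auto|].
      destruct (entry_total t k m Ht Hm) as [x Hx].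
      destruct (sequence_snoc u (l + m) x H1) as [u' [H1' [H2' H3']]].
      exists u'. rewrite add_sc_r. repeat split; auto.
      intros j y Hj Hy. apply lt_sc_iff in Hj. destruct Hj as [Hj| ->]; auto.
      rewrite (entry_fun _ _ _ _ Hy Hx). auto. }
  destruct (A k (lt_sc k)) as [u [H1 [H2 H3]]]. exists u. repeat split; auto.
  intros j x Hx. apply H3; auto. eapply entry_lt; eauto.
Qed.

(** * Extending and joining derivations *)

Definition monotone (step : (M -> Prop) -> M -> Prop) : Prop :=
  forall (P Q : M -> Prop) x, (forall y, P y -> Q y) -> step P x -> step Q x.

(** Closure of [derivable] under one more application of [step], whose premises occur in a common
    derivation [s]. *)
Lemma derivation_snoc step s x : monotone step -> (exists l, has_length s l) ->
  derivation step s -> step (fun y => exists i, entry s i y) x -> derivable step x.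
Proof.
  intros Hm [l Hs] Hd Hx. destruct (sequence_snoc s l x Hs) as [s' [H1 [H2 H3]]].
  exists s'. split; [|eauto]. intros i y Hy.
  destruct (entry_snoc_inv s s' l x Hs H1 H2 H3 i y Hy) as [K|[-> ->]].
  - generalize (Hd i y K). apply Hm. intros z [j [Hj Hz]]. exists j. auto.
  - revert Hx. apply Hm. intros z [j Hz]. exists j. split; auto. eapply entry_lt; eauto.
Qed.

(** Prepares rules with two premises. In the concatenation each entry has at least the predecessors
    it had before, so monotonicity preserves every step. *)
Lemma derivation_join step y z : monotone step -> derivable step y -> derivable step z ->
  exists s, (exists l, has_length s l) /\ derivation step s /\
    (exists i, entry s i y) /\ (exists i, entry s i z).
Proof.
  intros Hm [s [Hs [i Hi]]] [t [Ht [j Hj]]].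
  destruct (entry_has_length s i y Hi) as [l Hl], (entry_has_length t j z Hj) as [k Hk].
  destruct (sequence_concat s l t k Hl Hk) as [u [H1 [H2 H3]]].
  exists u. split; [eauto|]. split; [|split; eauto].
  intros a x Hx. assert (Ha := entry_lt _ _ _ _ H1 Hx).
  apply lt_add_cases in Ha. destruct Ha as [Ha|[b [Hb ->]]].
  - destruct (entry_total s l a Hl Ha) as [w Hw]. rewrite (entry_fun u a x w); auto.
    generalize (Hs a w Hw). apply Hm. intros v [c [Hc Hv]]. exists c; auto.
  - destruct (entry_total t k b Hk Hb) as [w Hw]. rewrite (entry_fun u (l + b) x w); auto.
    generalize (Ht b w Hw). apply Hm. intros v [c [Hc Hv]]. exists (l + c).
    split; auto. apply lt_add_l; auto.
Qed.

(** * Arithmetised syntax *)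

Fixpoint num (n : nat) : M := match n with O => 0 | S n => σ (num n) end.

Lemma num_inj m : forall n, num m = num n -> m = n.
Proof.
  induction m; intros []; simpl; intro H; auto.
  - symmetry in H. destruct (sc_neq_0 _ H).
  - destruct (sc_neq_0 _ H).
  - f_equal. apply IHm, sc_inj, H.
Qed.

(** Codes of syntax in the model, by tag: 0 variable, 1 zero, 2 successor, 3 sum, 4 product, 5
    equation, 6 negation, 7 disjunction, 8 conjunction, 9 existential, 10 universal. *)
Definition node1 (n : nat) (x : M) : M := pair (num n) x.
Definition node2 (n : nat) (x y : M) : M := pair (num n) (pair x y).

Definition is_var (v : M) : Prop := exists i, v = node1 0 i.

Definition term_step (P : M -> Prop) (x : M) : Prop :=
  is_var x \/ x = node1 1 0
  \/ (exists y, P y /\ x = node1 2 y)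
  \/ (exists y z, P y /\ P z /\ (x = node2 3 y z \/ x = node2 4 y z)).

Definition is_term : M -> Prop := derivable term_step.

Definition formula_step (P : M -> Prop) (x : M) : Prop :=
  (exists y z, is_term y /\ is_term z /\ x = node2 5 y z)
  \/ (exists y, P y /\ x = node1 6 y)
  \/ (exists y z, P y /\ P z /\ (x = node2 7 y z \/ x = node2 8 y z))
  \/ (exists v y, is_var v /\ P y /\ (x = node2 9 v y \/ x = node2 10 v y)).

Definition is_formula : M -> Prop := derivable formula_step.

Definition free_step (v : M) (P : M -> Prop) (x : M) : Prop :=
  x = v
  \/ (exists y, P y /\ (x = node1 2 y \/ x = node1 6 y))
  \/ (exists y z, (P y \/ P z) /\
       (x = node2 3 y z \/ x = node2 4 y z \/ x = node2 5 y z
        \/ x = node2 7 y z \/ x = node2 8 y z))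
  \/ (exists w y, w <> v /\ P y /\ (x = node2 9 w y \/ x = node2 10 w y)).

Definition free_in (v : M) : M -> Prop := derivable (free_step v).

Definition closed (x : M) : Prop := ~ (exists v, is_var v /\ free_in v x).

Definition is_sentence (x : M) : Prop := is_formula x /\ closed x.

Definition neg (x : M) : M := node1 6 x.
Definition disj (x y : M) : M := node2 7 x y.

Definition big_or_step (s : M) (P : M -> Prop) (x : M) : Prop :=
  (exists p, entry s 0 p /\ x = pair 0 p)
  \/ (exists i r p, P (pair i r) /\ entry s (σ i) p /\ x = pair (σ i) (disj r p)).

Definition big_or (s q : M) : Prop :=
  exists c, has_length s (σ c) /\ derivable (big_or_step s) (pair c q).

Lemma Dterm_node1 n k f : Dterm M n f -> Dterm M n (fun v => node1 k (f v)).
Proof. intros. unfold node1. definable. Qed.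

Lemma Dterm_node2 n k f g : Dterm M n f -> Dterm M n g -> Dterm M n (fun v => node2 k (f v) (g v)).
Proof. intros. unfold node2. definable. Qed.

Ltac definable_lemma ::=
  first [apply Dform_lt | apply Dterm_pair | apply Dform_has_length | apply Dform_entry
        | apply Dterm_node1 | apply Dterm_node2].

Lemma Dform_is_term n f : Dterm M n f -> Dform M n (fun v => is_term (f v)).
Proof. intros. unfold is_term, derivable, derivation, term_step, prior, is_var. definable. Qed.

Ltac definable_lemma ::=
  first [apply Dform_lt | apply Dterm_pair | apply Dform_has_length | apply Dform_entry
        | apply Dterm_node1 | apply Dterm_node2 | apply Dform_is_term].

(** Sentencehood being arithmetical, induction is available for it even though there is none for
    truth. *)
Lemma Dform_is_sentence n f : Dterm M n f -> Dform M n (fun v => is_sentence (f v)).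
Proof.
  intros. unfold is_sentence, is_formula, closed, free_in, derivable, derivation,
    formula_step, free_step, prior, is_var. definable.
Qed.

Ltac definable_lemma ::=
  first [apply Dform_lt | apply Dterm_pair | apply Dform_has_length | apply Dform_entry
        | apply Dterm_node1 | apply Dterm_node2 | apply Dform_is_sentence].

Lemma node1_inj m n x y : node1 m x = node1 n y -> m = n /\ x = y.
Proof. intro H. apply pair_inj in H. destruct H as [H ->]. apply num_inj in H. auto. Qed.

Lemma node2_inj m n x y x' y' : node2 m x y = node2 n x' y' -> m = n /\ x = x' /\ y = y'.
Proof.
  intro H. apply node1_inj in H. destruct H as [-> H]. apply pair_inj in H. tauto.
Qed.

Lemma node12_neq m n x y z : m <> n -> node1 m x <> node2 n y z.
Proof. intros N H. apply node1_inj in H. tauto. Qed.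

Ltac node_inj :=
  repeat match goal with
  | H : node1 _ _ = node1 _ _ |- _ => apply node1_inj in H; destruct H as [H ?]; try discriminate H
  | H : node2 _ _ _ = node2 _ _ _ |- _ =>
      apply node2_inj in H; destruct H as [H [? ?]]; try discriminate H
  | H : node1 _ _ = node2 _ _ _ |- _ => exfalso; revert H; apply node12_neq; discriminate
  | H : node2 _ _ _ = node1 _ _ |- _ =>
      exfalso; symmetry in H; revert H; apply node12_neq; discriminate
  | H : _ \/ _ |- _ => destruct H as [H|H]
  | H : _ /\ _ |- _ => destruct H
  | H : exists _, _ |- _ => destruct H
  end; subst.

(** Inversion of the last step: the tags rule out every clause but that of negation, including
    [x = v], as [v] is a variable. The premise lies in the same derivation. *)
Lemma free_in_neg v x : is_var v -> free_in v (neg x) -> free_in v x.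
Proof.
  intros [k ->] [s [Hs [i Hi]]]. assert (St := Hs _ _ Hi). unfold neg in St.
  unfold free_step in St. node_inj. destruct H as [j [_ Hj]]. exists s. eauto.
Qed.

Lemma free_in_disj v x y : is_var v -> free_in v (disj x y) -> free_in v x \/ free_in v y.
Proof.
  intros [k ->] [s [Hs [i Hi]]]. assert (St := Hs _ _ Hi). unfold disj in St.
  unfold free_step in St. node_inj; [left|right]; destruct H as [j [_ Hj]]; exists s; eauto.
Qed.

Lemma formula_step_monotone : monotone formula_step.
Proof.
  intros P Q x H [K|[[y [K E]]|[[y [z [K [L E]]]]|[v [y [V [K E]]]]]]].
  - left. exact K.
  - right; left. exists y. auto.
  - right; right; left. exists y, z. auto.
  - right; right; right. exists v, y. auto.
Qed.

Lemma sentence_neg x : is_sentence x -> is_sentence (neg x).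
Proof.
  intros [[s [Hs [i Hi]]] C]. split.
  - apply (derivation_snoc _ s); auto using formula_step_monotone.
    + eapply entry_has_length; eauto.
    + right; left. exists x. split; [eauto|reflexivity].
  - intros [v [Hv K]]. apply C. exists v. split; auto. apply free_in_neg; auto.
Qed.

Lemma sentence_disj x y : is_sentence x -> is_sentence y -> is_sentence (disj x y).
Proof.
  intros [Fx Cx] [Fy Cy]. split.
  - destruct (derivation_join _ x y formula_step_monotone Fx Fy) as [s [Hl [Hs [Hx Hy]]]].
    apply (derivation_snoc _ s); auto using formula_step_monotone.
    right; right; left. exists x, y. split; [exact Hx|]. split; [exact Hy|]. left; reflexivity.
  - intros [v [Hv K]]. apply free_in_disj in K; auto. destruct K; [apply Cx|apply Cy]; eauto.
Qed.

(** * Sequential induction *)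

Local Notation T := (tr M).

Definition true_entry (s i : M) : Prop := exists x, entry s i x /\ T x.

Hypothesis T_sentence : forall x, T x -> is_sentence x.
Hypothesis T_neg : forall p, is_sentence p -> (T (neg p) <-> ~ T p).
Hypothesis T_disj : forall p q, is_sentence p /\ is_sentence q -> (T (disj p q) <-> (T p \/ T q)).
Hypothesis T_big_or : forall s c,
  has_length s (σ c) /\ (forall i x, entry s i x -> is_sentence x) ->
  (exists q, big_or s q /\ T q) -> exists i, lt i (σ c) /\ true_entry s i.

(* [f] lists the disjuncts and [g] the pairs of [i] and the disjunction of the
   first [i + 1] disjuncts. *)
Definition least_failure (s f g k : M) : Prop :=
  has_length f (σ k) /\ has_length g (σ k) /\
  (exists x, entry s 0 x /\ entry f 0 (neg x) /\ entry g 0 (pair 0 (neg x)) /\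
    is_sentence (neg x)) /\
  (forall i, lt i k -> exists d x,
    entry g i (pair i d) /\ entry s (σ i) x /\ is_sentence d /\ is_sentence x /\
    entry f (σ i) (neg (disj d x)) /\
    entry g (σ i) (pair (σ i) (disj d (neg (disj d x))))).

(** The recursion for the disjuncts does not mention truth, so arithmetical induction on [k] builds
    [f] and [g] by appending one entry to each. *)
Lemma least_failure_exists s l j : has_length s l -> lt j l ->
  (forall i x, lt i (σ j) -> entry s i x -> is_sentence x) ->
  exists f g, least_failure s f g j.
Proof.
  intros Hs Hj S. assert (A : forall k, lt k (σ j) -> exists f g, least_failure s f g k);
    [|exact (A j (lt_sc j))].
  assert (L : forall k, lt k (σ j) -> exists x, entry s k x /\ is_sentence x).
  { intros k Hk. destruct (entry_total s l k Hs) as [x Hx].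
    - apply lt_sc_iff in Hk. destruct Hk as [Hk| ->]; auto. eapply lt_trans; eauto.
    - eauto. }
  intro k. unfold least_failure, neg, disj. model_induction k.
  - intros _. destruct (L 0 (lt_0_sc _)) as [x [Hx Sx]].
    destruct (sequence_snoc _ _ (neg x) empty_sequence) as [f [F1 [_ F3]]].
    destruct (sequence_snoc _ _ (pair 0 (neg x)) empty_sequence) as [g [G1 [_ G3]]].
    exists f, g. split; [exact F1|]. split; [exact G1|]. split.
    + exists x. split; auto. split; auto. split; auto. apply sentence_neg; auto.
    + intros i Hi. destruct (not_lt_0 _ Hi).
  - intro Hk. destruct IH as [f [g [F [G [[x0 [X1 [X2 [X3 X4]]]] St]]]]].
    { apply lt_trans with (σ k); auto using lt_sc. }
    destruct (L _ Hk) as [x [Hx Sx]].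
    (* The disjunction of the disjuncts so far: the first disjunct if [k] is 0, otherwise the one
       recorded by the preceding step. *)
    assert (D : exists d, entry g k (pair k d) /\ is_sentence d).
    { destruct (zero_or_sc k) as [->|[i ->]]; [eauto|].
      destruct (St i (lt_sc i)) as [d [y [_ [_ [Sd [Sy [_ Hg]]]]]]].
      eexists. split; [exact Hg|]. auto using sentence_disj, sentence_neg. }
    destruct D as [d [Hd Sd]].
    destruct (sequence_snoc f _ (neg (disj d x)) F) as [f' [F1 [F2 F3]]].
    destruct (sequence_snoc g _ (pair (σ k) (disj d (neg (disj d x)))) G) as [g' [G1 [G2 G3]]].
    exists f', g'. split; [exact F1|]. split; [exact G1|]. split.
    + exists x0. auto.
    + intros i Hi. apply lt_sc_iff in Hi. destruct Hi as [Hi| ->].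
      * destruct (St i Hi) as [d' [y [E1 [E2 [E3 [E4 [E5 E6]]]]]]].
        exists d', y. auto 10.
      * exists d, x. auto 10.
Qed.

Lemma least_failure_sentences s f g k : least_failure s f g k ->
  forall i x, entry f i x -> is_sentence x.
Proof.
  intros [F [G [[x0 [X1 [X2 [X3 X4]]]] St]]] i x Hx.
  destruct (zero_or_sc i) as [->|[j ->]].
  - rewrite (entry_fun _ _ _ _ Hx X2). auto.
  - destruct (St j) as [d [y [E1 [E2 [E3 [E4 [E5 E6]]]]]]].
    + apply lt_sc_sc, (entry_lt _ _ _ _ F Hx).
    + rewrite (entry_fun _ _ _ _ Hx E5). auto using sentence_disj, sentence_neg.
Qed.

(** The sequence [g] of partial disjunctions is itself a derivation for [big_or_step]. *)
Lemma least_failure_big_or s f g k q : least_failure s f g k ->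
  entry g k (pair k q) -> big_or f q.
Proof.
  intros [F [G [[x0 [X1 [X2 [X3 X4]]]] St]]] Hq. exists k. split; auto.
  exists g. split; [|eauto]. intros i y Hy.
  destruct (zero_or_sc i) as [->|[j ->]].
  - left. exists (neg x0). split; auto. eapply entry_fun; eauto.
  - destruct (St j) as [d [x [E1 [E2 [E3 [E4 [E5 E6]]]]]]].
    + apply lt_sc_sc, (entry_lt _ _ _ _ G Hy).
    + right. exists j, d, (neg (disj d x)). split; [|split; auto; eapply entry_fun; eauto].
      exists j. auto using lt_sc.
Qed.

Lemma sentence_sequence_induction s l j : has_length s l -> lt j l ->
  (forall i x, lt i (σ j) -> entry s i x -> is_sentence x) ->
  true_entry s 0 -> (forall i, lt (σ i) l -> true_entry s i -> true_entry s (σ i)) ->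
  true_entry s j.
Proof.
  intros Hs Hj S T0 TS. apply NNPP. intro N.
  destruct (least_failure_exists s l j Hs Hj S) as [f [g LF]].
  assert (LF' := LF). destruct LF' as [F [G [[x0 [X1 [X2 [X3 X4]]]] St]]].
  assert (Tx0 : T x0).
  { destruct T0 as [x [Hx Tx]]. rewrite (entry_fun _ _ _ _ X1 Hx). auto. }
  assert (Step : forall d x, is_sentence d -> is_sentence x ->
    (T (disj d (neg (disj d x))) <-> T d \/ ~ T x)).
  { intros d x Sd Sx. assert (K := sentence_disj _ _ Sd Sx).
    rewrite T_disj, T_neg, T_disj by auto using sentence_neg. tauto. }
  assert (Tq : exists q, big_or f q /\ T q).
  { destruct (zero_or_sc j) as [->|[i ->]]; [destruct N; exact T0|].
    destruct (St i (lt_sc i)) as [d [x [E1 [E2 [E3 [E4 [E5 E6]]]]]]].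
    eexists. split; [eapply least_failure_big_or; [exact LF|exact E6]|].
    apply Step; auto. right. intro Tx. apply N. exists x; auto. }
  destruct (T_big_or f j) as [i [Hi [y [Hy Ty]]]]; auto.
  { split; auto. eapply least_failure_sentences; eauto. }
  destruct (zero_or_sc i) as [->|[k ->]].
  { rewrite (entry_fun _ _ _ _ Hy X2) in Ty. apply T_neg in Ty; auto. }
  apply (proj1 (lt_sc_sc _ _)) in Hi.
  destruct (St k Hi) as [d [x [E1 [E2 [E3 [E4 [E5 E6]]]]]]].
  rewrite (entry_fun _ _ _ _ Hy E5) in Ty.
  rewrite T_neg, T_disj in Ty by auto using sentence_disj.
  assert (Tk : true_entry s k).
  { destruct (zero_or_sc k) as [->|[m ->]]; [exact T0|].
    destruct (St m) as [d' [x' [E1' [E2' [E3' [E4' [E5' E6']]]]]]].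
    { apply lt_trans with (σ m); auto using lt_sc. }
    (* For [k = σ m], the disjunction [d] at [k] is the one built at step [m] from [d'] and [x']. It
       would be true if [x'] were not, while [Ty] says that it is not. *)
    assert (Ed := entry_fun _ _ _ _ E1 E6'). apply pair_inj in Ed. destruct Ed as [_ ->].
    exists x'. split; auto. apply NNPP. intro Nx. apply Ty. left. apply Step; auto. }
  apply Ty. right. destruct (TS k) as [z [Hz Tz]]; auto.
  { destruct Hi as [a Ha], Hj as [b Hb]. exists (a + b). rewrite <- Hb, <- Ha. mring. }
  rewrite (entry_fun _ _ _ _ E2 Hz). auto.
Qed.

Lemma sequential_induction s l : has_length s l ->
  true_entry s 0 /\ (forall i, lt (σ i) l -> true_entry s i -> true_entry s (σ i)) ->
  forall j, lt j l -> true_entry s j.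
Proof.
  intros Hs [T0 TS].
  (* This statement is arithmetical and so open to induction, although its induction step argues
     through truth: a true entry is a sentence. *)
  assert (S : forall j, lt j l -> forall i x, lt i (σ j) -> entry s i x -> is_sentence x).
  { intro j. model_induction j.
    - intros _ i x Hi Hx. apply lt_sc_iff in Hi. destruct Hi as [Hi| ->];
        [destruct (not_lt_0 _ Hi)|].
      destruct T0 as [y [Hy Ty]]. rewrite (entry_fun _ _ _ _ Hx Hy). auto.
    - intros Hj i x Hi Hx.
      assert (Hj' : lt j l) by (apply lt_trans with (σ j); auto using lt_sc).
      apply lt_sc_iff in Hi. destruct Hi as [Hi| ->]; [eapply IH; eauto|].
      destruct (TS j Hj) as [y [Hy Ty]].
      { apply (sentence_sequence_induction s l j Hs Hj' (IH Hj') T0 TS). }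
      rewrite (entry_fun _ _ _ _ Hx Hy). auto. }
  intros j Hj. exact (sentence_sequence_induction s l j Hs Hj (S j Hj) T0 TS).
Qed.

End Model.

(** * From models to provability *)

Lemma fv_fold_all l p x : In x (fv (fold_right fAll p l)) -> In x (fv p) /\ ~ In x l.
Proof.
  induction l as [|y l IH]; simpl; [tauto|].
  intro H. apply in_remove in H. destruct H as [H N]. apply IH in H.
  intuition congruence.
Qed.

Lemma fv_closure p : fv (closure p) = [].
Proof.
  destruct (fv (closure p)) as [|x l] eqn:E; auto.
  destruct (fv_fold_all (fv p) p x); [|tauto].
  unfold closure in E. rewrite E. simpl; auto.
Qed.

Lemma CTminus_closed p : CTminus p -> fv p = [].
Proof.
  intros [q Hq| | | | | | | |]; try (vm_compute; reflexivity).
  destruct Hq; try (vm_compute; reflexivity). apply fv_closure.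
Qed.

Theorem theorem3p2 : proves (add_axiom CTminus DC_out) SeqInd.
Proof.
  apply completeness.
  - intros q [H| ->]; [apply CTminus_closed; auto | vm_compute; reflexivity].
  - intros M r H.
    assert (HCT : forall q r, CTminus q -> sat M r q) by (intros; apply H; left; auto).
    (* The notions defined in the model repeat the formulas clause by clause, so satisfaction of the
       axioms and of the conclusion is convertible to the statements used there. *)
    exact (sequential_induction M (fun q r K => HCT q r (CT_PA q K))
      (HCT _ r CT_sentences) (HCT _ r CT_not) (HCT _ r CT_or) (H _ r (or_intror eq_refl))).
Qed.
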